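(* Let $\underline{X}=V(x_1\cdots x_r)\subseteq(\mathbb{C}^n,0)$ be a normal crossings germ with singular locus $D$ and irreducible components $X_i=V(x_i)$, $1\le i\le r$. Let $\mathscr{F}$ be a germ of semistable foliation of codimension one on $\underline{X}$, and let $\mathscr{F}_i$ be the restriction of $\mathscr{F}$ to $X_i$. Assume that each divisor $D_i=D\cap X_i\subseteq X_i$ is $\mathscr{F}_i$-invariant. Then for all $i\neq j$, writing $D_{ij}=X_i\cap X_j$, the Camacho–Sad indices satisfy $$CS(\mathscr{F}_i,D_{ij},0)+CS(\mathscr{F}_j,D_{ij},0)=r-2.$$
   Context: All spaces are complex analytic. Monoids are commutative, finitely generated, integral and saturated. A log structure on $\underline{X}$ is a sheaf of monoids $\mathcal{M}_X$ with a multiplicative morphism $\alpha:\mathcal{M}_X\to\mathcal{O}_X$ such that $\alpha^{-1}(\mathcal{O}_X^* )\to\mathcal{O}_X^*$ is an isomorphism. The standard log point $(\ast,\mathbb{N})$ is the point with the log structure associated to $\mathbb{N}\to\mathbb{C}$, $0\mapsto 1$, $k\mapsto 0$ for $k>0$. A semistable map is a morphism of log spaces $f:(\underline{X},\mathcal{M}_X)\to(\ast,\mathbb{N})$, with $\underline{X}$ a normal crossings variety, such that locally on $\underline{X}$ there are charts $\mathbb{N}^r\to\Gamma(U,\mathcal{M}_X)$ whose composition with the diagonal $\mathbb{N}\to\mathbb{N}^r$ equals $\mathbb{N}\to\Gamma(\ast,\mathcal{M}_{(\ast,\mathbb{N})})\xrightarrow{f^\flat}\Gamma(U,\mathcal{M}_X)$;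 locally $\underline{X}=V(x_1\cdots x_r)$ and $e_i\mapsto \bar x_i/u_i$ with $u_i$ units. The sheaf $T_{X/(\ast,\mathbb{N})}$ of relative log derivations consists of pairs $(v,\delta)$ with $v$ a $\mathbb{C}$-linear derivation of $\mathcal{O}_X$ and $\delta:\mathcal{M}_X\to\mathcal{O}_X$ such that $\delta(ab)=\delta(a)+\delta(b)$, $\alpha(a)\delta(a)=v(\alpha(a))$ and $\delta\circ f^\flat=0$. For a semistable map, $(v,\delta)\mapsto v$ identifies it with a subsheaf of $T_{\underline{X}}$. A foliation of codimension $q$ on $\underline{X}$ is a coherent subsheaf $T_{\mathscr{F}}\subseteq T_{\underline{X}}$ closed under the Lie bracket whose quotient $N_{\mathscr F}$ is torsion-less (i.e. injects into its double dual) of rank $q$. The foliation is semistable if there is a semistable map $(\underline{X},\mathcal{M}_X)\to(\ast,\mathbb{N})$ with $T_{\mathscr{F}}\subseteq T_{X/(\ast,\mathbb{N})}$. Its restriction $\mathscr{F}_i$ to $X_i$ is the (saturated) codimension one foliation on the smooth germ $X_i$ induced by the image of $T_{\mathscr{F}}\to T_{X_i}$. Camacho–Sad index (sign convention used in this result; here $n\ge 3$). Let $\mathscr{G}$ be a codimension one foliation on a smooth germ $(M,0)$, defined by a holomorphic $1$-form $\omega$ with zero locus of codimension at least $2$, and let $Y=\{y=0\}$ be a smooth invariant hypersurface through $0$. Write $\omega=h\,dy+y\,\eta$ with $h|_Y\not\equiv 0$. Then $(\eta/h)|_Y$ is a closed meromorphic $1$-form on $Y$, and $CS(\mathscr{G},Y,0)=\mathrm{Res}_0\big((\eta/h)|_Y\big)$.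 If $\dim Y=1$ this is the ordinary residue at $0$; if $\dim Y\geq 2$ it is the residue at $0$ of the restriction to a generic smooth curve germ in $Y$ through $0$. *)

(* Defs.v *)
From HB Require Import structures.
From mathcomp Require Import all_boot all_order all_algebra.
From mathcomp Require Import generic_quotient ring_quotient.
From mathcomp Require Import boolp reals complex mpoly.

Set Implicit Arguments.
Unset Strict Implicit.
Unset Printing Implicit Defensive.

Import Order.TTheory GRing.Theory Num.Theory.
Local Open Scope ring_scope.
Local Open Scope quotient_scope.

Record fps (K : nzRingType) (n : nat) := FPS { fcoef :> 'X_{1..n} -> K }.

HB.instance Definition _ K n := gen_eqMixin (fps K n).
HB.instance Definition _ K n := gen_choiceMixin (fps K n).

Section FormalRing.
Variables (K : comNzRingType) (n : nat).
Implicit Types (f g h : fps K n) (m : 'X_{1..n}).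

Lemma fpsP f g : f =1 g -> f = g.
Proof. by case: f g => [f] [g] /= /funext ->. Qed.

Definition fps_const (c : K) : fps K n := FPS (fun m => c *+ (m == 0%MM)).
Definition fps_add f g : fps K n := FPS (fun m => f m + g m).
Definition fps_opp f : fps K n := FPS (fun m => - f m).
Definition fps_mul f g : fps K n := FPS (fun m =>
  \sum_(k : 'X_{1..n < (mdeg m).+1, (mdeg m).+1} | m == (k.1 + k.2)%MM)
     f k.1 * g k.2).

Lemma fps_addA : associative fps_add.
Proof. by move=> f g h; apply: fpsP => m /=; rewrite addrA. Qed.
Lemma fps_addC : commutative fps_add.
Proof. by move=> f g; apply: fpsP => m /=; rewrite addrC. Qed.
Lemma fps_add0 : left_id (fps_const 0) fps_add.
Proof. by move=> f; apply: fpsP => m /=; rewrite mul0rn add0r. Qed.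
Lemma fps_addN : left_inverse (fps_const 0) fps_opp fps_add.
Proof. by move=> f; apply: fpsP => m /=; rewrite addNr mul0rn. Qed.

HB.instance Definition _ := GRing.isZmodule.Build (fps K n)
  fps_addA fps_addC fps_add0 fps_addN.

Definition fps_trunc d f : {mpoly K[n]} :=
  \sum_(m : 'X_{1..n < d}) f m *: 'X_[m].

Lemma fps_truncE d f m : (mdeg m < d)%N -> (fps_trunc d f)@_m = f m.
Proof. exact: mcoeff_mpoly. Qed.

Lemma mcoeffM_low (p p' q q' : {mpoly K[n]}) m :
  (forall k, (mdeg k <= mdeg m)%N -> p@_k = p'@_k) ->
  (forall k, (mdeg k <= mdeg m)%N -> q@_k = q'@_k) ->
  (p * q)@_m = (p' * q')@_m.
Proof.
move=> hp hq; rewrite !mcoeffM; apply: eq_bigr => -[k l] _ /=.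
by rewrite hp ?hq // -ltnS bmdeg.
Qed.

Lemma fps_mulE d f g m : (mdeg m < d)%N ->
  fps_mul f g m = (fps_trunc d f * fps_trunc d g)@_m.
Proof.
move=> md; rewrite mcoeffM /=; apply: eq_bigr => -[k l] _ /=.
by rewrite !fps_truncE // (leq_trans (bmdeg _)).
Qed.

Lemma fps_mulA : associative fps_mul.
Proof.
move=> f g h; apply: fpsP => m.
pose d := (mdeg m).+1.
have md : (mdeg m < d)%N by [].
rewrite !(@fps_mulE d) //.
transitivity (fps_trunc d f * (fps_trunc d g * fps_trunc d h))@_m.
  apply: mcoeffM_low => // k km.
  by rewrite fps_truncE ?ltnS // (@fps_mulE d) ?ltnS.
rewrite mulrA; apply: mcoeffM_low => // k km.
by rewrite fps_truncE ?ltnS // (@fps_mulE d) ?ltnS.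
Qed.

Lemma fps_mulC : commutative fps_mul.
Proof.
move=> f g; apply: fpsP => m.
by rewrite !(@fps_mulE (mdeg m).+1) // mulrC.
Qed.

Lemma fps_mul1 : left_id (fps_const 1) fps_mul.
Proof.
move=> f; apply: fpsP => m.
rewrite (@fps_mulE (mdeg m).+1) //.
rewrite -[RHS](@fps_truncE (mdeg m).+1) // -[in RHS](mul1r (fps_trunc _ _)).
apply: mcoeffM_low => // k km.
by rewrite fps_truncE ?ltnS // mcoeff1.
Qed.

Lemma fps_mulDl : left_distributive fps_mul fps_add.
Proof.
move=> f g h; apply: fpsP => m /=; rewrite -big_split /=.
by apply: eq_bigr => k _; rewrite mulrDl.
Qed.

Lemma fps_1neq0 : fps_const 1 != 0 :> fps K n.
Proof.
apply/eqP => /(congr1 (fun f : fps K n => f 0%MM)) /=.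
by rewrite eqxx /= => /eqP; rewrite oner_eq0.
Qed.

HB.instance Definition _ := GRing.Zmodule_isComNzRing.Build (fps K n)
  fps_mulA fps_mulC fps_mul1 fps_mulDl fps_1neq0.

Definition fps_var (i : 'I_n) : fps K n := FPS (fun m => (m == U_(i)%MM)%:R).

Definition fps_deriv (i : 'I_n) f : fps K n :=
  FPS (fun m => f (m + U_(i))%MM *+ (m i).+1).

End FormalRing.

Section Convergent.
Variables (K : numFieldType) (n : nat).

(* Absolute convergence on some polydisc of radius rho: the partial sums of the
   series of absolute values at (rho, ..., rho) are bounded. *)
Definition convergent_at (f : fps K n) (rho : K) :=
  exists M : K, forall d : nat,
    \sum_(m : 'X_{1..n < d}) `|f m| * rho ^+ mdeg m <= M.

Definition convergent : {pred fps K n} :=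
  fun f => `[< exists2 rho : K, 0 < rho & convergent_at f rho >].

Lemma convergent_at_le (f : fps K n) (r s : K) :
  0 <= s -> s <= r -> convergent_at f r -> convergent_at f s.
Proof.
move=> s0 sr [M hM]; exists M => d; apply: le_trans (hM d).
apply: ler_sum => m _; apply: ler_wpM2l => //.
by apply: lerXn2r; rewrite // nnegrE ?(le_trans s0).
Qed.

Lemma common_radius (r s : K) : 0 < r -> 0 < s ->
  exists t : K, [/\ 0 < t, t <= r & t <= s].
Proof.
move=> r0 s0; exists (r * s / (r + s)).
have rs0 : 0 < r + s by rewrite addr_gt0.
split; first by rewrite divr_gt0 ?mulr_gt0.
  by rewrite ler_pdivrMr // ler_pM2l // lerDr ltW.
by rewrite ler_pdivrMr // mulrC ler_pM2l // lerDl ltW.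
Qed.

Lemma fps_mul_bound (f g : fps K n) d (m : 'X_{1..n < d}) (r : K) : 0 <= r ->
  `|(f * g) m| * r ^+ mdeg m <=
  \sum_(k : 'X_{1..n < d, d} | bmnm m == (k.1 + k.2)%MM)
     (`|f k.1| * r ^+ mdeg k.1) * (`|g k.2| * r ^+ mdeg k.2).
Proof.
move=> r0.
rewrite [(f * g) m](@fps_mulE _ _ d _ _ _ (bmdeg m)).
rewrite (mcoeff_poly_mul _ _ (bmdeg m)).
apply: le_trans (_ : (\sum_(k : 'X_{1..n < d, d} | bmnm m == (k.1 + k.2)%MM)
  `|f k.1| * `|g k.2|) * r ^+ mdeg m <= _).
  apply: ler_wpM2r; first exact: exprn_ge0.
  apply: le_trans (ler_norm_sum _ _ _) _; apply: ler_sum => k _.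
  by rewrite !fps_truncE ?bmdeg // normrM.
rewrite mulr_suml; apply: ler_sum => k /eqP ->.
by rewrite mdegD exprD mulrACA.
Qed.

Lemma convergent_subring : subring_closed convergent.
Proof.
split.
- apply/asboolP; exists 1 => //; exists 1 => d.
  case: d => [|d].
    by rewrite big1 // => -[m hm]; exfalso; rewrite ltn0 in hm.
  rewrite (bigD1 bm0) //= big1 => [|m].
    by rewrite eqxx mdeg0 normr1 mulr1 addr0.
  by rewrite bmeqP /= => /negPf ->; rewrite normr0 mul0r.
- move=> f g /asboolP[r r0 hr] /asboolP[s s0 hs]; apply/asboolP.
  have [t [t0 tr ts]] := common_radius r0 s0; exists t => //.
  have [M hM] := convergent_at_le (ltW t0) tr hr.
  have [N hN] := convergent_at_le (ltW t0) ts hs.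
  exists (M + N) => d; apply: le_trans (lerD (hM d) (hN d)).
  rewrite -big_split /=; apply: ler_sum => m _.
  by rewrite -mulrDl ler_wpM2r ?exprn_ge0 ?(ltW t0) ?ler_normB.
- move=> f g /asboolP[r r0 hr] /asboolP[s s0 hs]; apply/asboolP.
  have [t [t0 tr ts]] := common_radius r0 s0; exists t => //.
  have [M hM] := convergent_at_le (ltW t0) tr hr.
  have [N hN] := convergent_at_le (ltW t0) ts hs.
  have pos (h : fps K n) (m : 'X_{1..n}) : 0 <= `|h m| * t ^+ mdeg m.
    by rewrite mulr_ge0 // exprn_ge0 // ltW.
  exists (M * N) => d.
  apply: le_trans (ler_pM (sumr_ge0 _ (fun m _ => pos f (bmnm m)))
    (sumr_ge0 _ (fun m _ => pos g (bmnm m))) (hM d) (hN d)).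
  apply: le_trans (ler_sum _ (fun m _ => fps_mul_bound f g m (ltW t0))) _.
  rewrite big_distrl /=.
  under [leRHS]eq_bigr do rewrite big_distrr /=.
  rewrite [leRHS]pair_bigA /= (exchange_big_dep xpredT) //=.
  apply: ler_sum => k _.
  case: (pickP (fun m : 'X_{1..n < d} => bmnm m == (k.1 + k.2)%MM)) => [m0 km0|km].
    rewrite (bigD1 m0) //= big1 ?addr0 // => m /andP[/eqP mk].
    by rewrite bmeqP mk (eqP km0) eqxx.
  by rewrite (eq_bigl _ _ km) big_pred0_eq mulr_ge0.
Qed.

End Convergent.


HB.instance Definition _ (K : numFieldType) n :=
  GRing.isSubringClosed.Build (fps K n) (@convergent K n)
    (@convergent_subring K n).

(* For K = C, the ring of germs at 0 of holomorphic functions on C^n. *)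
Record holo (K : numFieldType) (n : nat) :=
  Holo { holo_val :> fps K n; _ : holo_val \in @convergent K n }.

HB.instance Definition _ K n := [isSub for @holo_val K n].
HB.instance Definition _ K n := [Choice of holo K n by <:].
HB.instance Definition _ K n := [SubChoice_isSubComNzRing of holo K n by <:].

Section Holo.
Variables (K : numFieldType).

Lemma sum_inj_le (I J : finType) (P : pred I) (h : I -> J) (F : J -> K) :
  {in P &, injective h} -> (forall j, 0 <= F j) ->
  \sum_(i | P i) F (h i) <= \sum_j F j.
Proof.
move=> hinj F0; rewrite -(big_imset F hinj) /=.
by rewrite [leRHS](bigID (mem (h @: P))) /= lerDl sumr_ge0.
Qed.

Lemma convergent_finite n (f : fps K n) d :
  (forall m, (d < mdeg m)%N -> f m = 0) -> f \in @convergent K n.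
Proof.
move=> f0; apply/asboolP; exists 1 => //.
exists (\sum_(m : 'X_{1..n < d.+1}) `|f m|) => e.
rewrite (bigID (fun m : 'X_{1..n < e} => mdeg m <= d)%N) /= addrC big1 ?add0r.
  apply: le_trans (sum_inj_le (P := fun m : 'X_{1..n < e} => (mdeg m <= d)%N)
    (h := fun m => insubd (bm0 : 'X_{1..n < d.+1}) (bmnm m))
    (F := fun m : 'X_{1..n < d.+1} => `|f m|) _ _) => //.
    apply: ler_sum => m md.
    by rewrite expr1n mulr1 -[X in _ <= `|f X|]/(val _) val_insubd ltnS md.
  move=> m m' md m'd /(congr1 val); rewrite !val_insubd !ltnS.
  by move: md m'd; rewrite !unfold_in => -> -> /val_inj.
by move=> m; rewrite -ltnNge => /f0 ->; rewrite normr0 mul0r.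
Qed.

Lemma const_subproof n (c : K) : fps_const n c \in @convergent K n.
Proof.
apply: (@convergent_finite _ _ 0) => m; rewrite lt0n mdeg_eq0 /= => /negPf ->.
by rewrite mulr0n.
Qed.
Definition const n (c : K) : holo K n := Holo (const_subproof n c).

Lemma var_subproof n (i : 'I_n) : fps_var K i \in @convergent K n.
Proof.
apply: (@convergent_finite _ _ 1) => m /=; case: eqP => // ->.
by rewrite mdeg1.
Qed.
Definition var n (i : 'I_n) : holo K n := Holo (var_subproof i).

(* Restriction of functions to the coordinate hyperplane x_i = 0, a copy of
   K^(n-1) whose l-th coordinate is x_(lift i l). *)
Definition mnm_restr n (i : 'I_n) (m : 'X_{1..n.-1}) : 'X_{1..n} :=
  [multinom oapp m 0%N (unlift i k) | k < n].

Definition fps_restr n (i : 'I_n) (f : fps K n) : fps K n.-1 :=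
  FPS (fun m => f (mnm_restr i m)).

Lemma mdeg_restr n (i : 'I_n) (m : 'X_{1..n.-1}) : mdeg (mnm_restr i m) = mdeg m.
Proof.
case: n i m => [|n] i m; first by case: i.
rewrite !mdegE (bigD1_ord i) //= mnmE unlift_none add0n.
by apply: eq_bigr => k _; rewrite mnmE liftK.
Qed.

Lemma mnm_restr_inj n (i : 'I_n) : injective (mnm_restr i).
Proof.
case: n i => [|n] i m m'; first by case: i.
move=> /mnmP h; apply/mnmP => k.
by have := h (lift i k); rewrite !mnmE liftK.
Qed.

Lemma restr_subproof n (i : 'I_n) (f : holo K n) :
  fps_restr i f \in @convergent K n.-1.
Proof.
case: f => f /= /asboolP[r r0 [M hM]]; apply/asboolP; exists r => //.
exists M => d; apply: le_trans (hM d).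
have hd (m : 'X_{1..n.-1 < d}) : (mdeg (mnm_restr i m) < d)%N.
  by rewrite mdeg_restr bmdeg.
apply: le_trans (sum_inj_le (P := xpredT) (h := fun m => BMultinom (hd m))
  (F := fun m : 'X_{1..n < d} => `|f m| * r ^+ mdeg m) _ _).
- by apply: ler_sum => m _; rewrite /= mdeg_restr.
- by move=> m m' _ _ /(congr1 (@bmnm _ _)) /= /mnm_restr_inj /val_inj.
- by move=> m; rewrite mulr_ge0 // exprn_ge0 // ltW.
Qed.
Definition restr n (i : 'I_n) (f : holo K n) : holo K n.-1 :=
  Holo (restr_subproof i f).

End Holo.

(* The quotient of a commutative ring by a principal ideal; unlike
   {ideal_quot _} it does not require the ideal to be proper. *)
Section Hypersurface.
Variables (A : comNzRingType) (f : A).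

Definition princ : {pred A} := fun a => `[< exists b, a = b * f >].

Lemma princ_zmod_closed : zmod_closed princ.
Proof.
split; first by apply/asboolP; exists 0; rewrite mul0r.
move=> _ _ /asboolP[a ->] /asboolP[b ->]; apply/asboolP; exists (a - b).
by rewrite mulrBl.
Qed.
HB.instance Definition _ := GRing.isZmodClosed.Build A princ princ_zmod_closed.

Lemma princMr a b : b \in princ -> a * b \in princ.
Proof. by move=> /asboolP[c ->]; apply/asboolP; exists (a * c); rewrite mulrA. Qed.

Definition quo := Quotient.quot princ.
HB.instance Definition _ := GRing.Zmodule.on quo.

Definition cls (a : A) : quo := \pi_(Quotient.quot princ) a.

Lemma cls_eqP a b : reflect (cls a = cls b) (a - b \in princ).
Proof. by rewrite Quotient.idealrBE; apply: eqP. Qed.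

Lemma cls_surj (x : quo) : exists a, x = cls a.
Proof. by exists (repr x); rewrite /cls reprK. Qed.

Lemma clsB a b : cls (a - b) = cls a - cls b.
Proof. exact: raddfB. Qed.
Lemma clsD a b : cls (a + b) = cls a + cls b.
Proof. exact: raddfD. Qed.

Definition quo_mul (x y : quo) : quo :=
  cls (repr (x : Quotient.quot princ) * repr (y : Quotient.quot princ)).

Lemma clsM a b : cls (a * b) = quo_mul (cls a) (cls b).
Proof.
apply/cls_eqP.
have h c : c - repr (cls c : Quotient.quot princ) \in princ.
  by apply/cls_eqP; rewrite /cls reprK.
set a' := repr _; set b' := repr _.
have -> : a * b - a' * b' = b * (a - a') + a' * (b - b').
  by rewrite !mulrBr (mulrC b a) (mulrC b a') addrA subrK.
by rewrite rpredD // princMr // h.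
Qed.

Lemma quo_mulA : associative quo_mul.
Proof.
move=> x y z; have [a ->] := cls_surj x; have [b ->] := cls_surj y.
by have [c ->] := cls_surj z; rewrite -!clsM mulrA.
Qed.
Lemma quo_mulC : commutative quo_mul.
Proof.
move=> x y; have [a ->] := cls_surj x; have [b ->] := cls_surj y.
by rewrite -!clsM mulrC.
Qed.
Lemma quo_mul1 : left_id (cls 1) quo_mul.
Proof. by move=> x; have [a ->] := cls_surj x; rewrite -clsM mul1r. Qed.
Lemma quo_mulDl : left_distributive quo_mul +%R.
Proof.
move=> x y z; have [a ->] := cls_surj x; have [b ->] := cls_surj y.
by have [c ->] := cls_surj z; rewrite -clsD -!clsM mulrDl clsD.
Qed.

HB.instance Definition _ := GRing.Zmodule_isComPzRing.Build quo
  quo_mulA quo_mulC quo_mul1 quo_mulDl.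

HB.instance Definition _ := GRing.isZmodMorphism.Build A quo cls clsB.
HB.instance Definition _ := GRing.isMonoidMorphism.Build A quo cls
  (erefl, clsM).

End Hypersurface.

Section Derivations.
Variables (K : Type) (A : comPzRingType) (k : K -> A).

Record der := Der {
  der_fun :> A -> A;
  derD : forall a b, der_fun (a + b) = der_fun a + der_fun b;
  derM : forall a b, der_fun (a * b) = a * der_fun b + b * der_fun a;
  derC : forall c a, der_fun (k c * a) = k c * der_fun a }.

HB.instance Definition _ := gen_eqMixin der.
HB.instance Definition _ := gen_choiceMixin der.

Lemma derP (v w : der) : v =1 w -> v = w.
Proof.
case: v w => [v v1 v2 v3] [w w1 w2 w3] /= /funext e.
by case: _ / e w1 w2 w3 => *; congr Der; apply: Prop_irrelevance.
Qed.

Definition der0 : der.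
Proof. by exists (fun=> 0) => *; rewrite ?mulr0 ?addr0. Defined.

Definition der_add (v w : der) : der.
Proof.
exists (fun a => v a + w a) => [a b|a b|c a].
- by rewrite !derD addrACA.
- by rewrite !derM !mulrDr addrACA.
- by rewrite !derC mulrDr.
Defined.

Definition der_scale (c : A) (v : der) : der.
Proof.
exists (fun a => c * v a) => [a b|a b|d a].
- by rewrite derD mulrDr.
- by rewrite derM mulrDr !(mulrCA c).
- by rewrite derC mulrCA.
Defined.

Lemma der_addA : associative der_add.
Proof. by move=> u v w; apply: derP => a /=; rewrite addrA. Qed.
Lemma der_addC : commutative der_add.
Proof. by move=> u v; apply: derP => a /=; rewrite addrC. Qed.
Lemma der_add0 : left_id der0 der_add.
Proof. by move=> u; apply: derP => a /=; rewrite add0r. Qed.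
Lemma der_addN : left_inverse der0 (der_scale (-1)) der_add.
Proof. by move=> u; apply: derP => a /=; rewrite mulN1r addNr. Qed.

HB.instance Definition _ := GRing.isZmodule.Build der
  der_addA der_addC der_add0 der_addN.

Lemma der_scaleA a b v : der_scale a (der_scale b v) = der_scale (a * b) v.
Proof. by apply: derP => x /=; rewrite mulrA. Qed.
Lemma der_scale1 : left_id 1 der_scale.
Proof. by move=> v; apply: derP => x /=; rewrite mul1r. Qed.
Lemma der_scaleDr : right_distributive der_scale +%R.
Proof. by move=> a v w; apply: derP => x /=; rewrite mulrDr. Qed.
Lemma der_scaleDl v : {morph der_scale^~ v : a b / a + b}.
Proof. by move=> a b; apply: derP => x /=; rewrite mulrDl. Qed.

HB.instance Definition _ := GRing.Zmodule_isLmodule.Build A der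
  der_scaleA der_scale1 der_scaleDr der_scaleDl.

Definition lie_bracket (v w : der) : der.
Proof.
exists (fun a => v (w a) - w (v a)) => [a b|a b|c a].
- by rewrite !derD opprD addrACA.
- rewrite !derM !derD !derM (mulrC (v b)) (mulrC (v a)).
  rewrite (addrACA (a * v (w b))) (addrACA (a * w (v b))).
  rewrite (addrC (w a * v b)) opprD [LHS]addrACA subrr addr0 !mulrBr.
  by rewrite opprD addrACA.
- by rewrite !derC mulrBr.
Defined.

Definition is_prime_ideal (p : A -> Prop) : Prop :=
  [/\ p 0, forall a b, p a -> p b -> p (a + b), forall a b, p b -> p (a * b),
      ~ p 1 & forall a b, p (a * b) -> p a \/ p b].

Definition is_minimal_prime (p : A -> Prop) : Prop :=
  is_prime_ideal p /\
  forall p' : A -> Prop, is_prime_ideal p' ->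
    (forall a, p' a -> p a) -> forall a, p a -> p' a.

(* v_1, ..., v_m are linearly independent in (Der / T)_p, for a prime p such
   that A_p is a field: c_i vanishes in A_p iff c_i is in p, and an element u of
   Der vanishes in (Der / T)_p iff s *: u is in T for some s outside p. *)
Definition free_at (T : der -> Prop) (p : A -> Prop) m (v : 'I_m -> der) : Prop :=
  forall c : 'I_m -> A,
    (exists2 s, ~ p s & T (s *: \sum_(i < m) c i *: v i)) -> forall i, p (c i).

Definition quotient_rank_at (T : der -> Prop) (p : A -> Prop) (q : nat) : Prop :=
  (exists v : 'I_q -> der, free_at T p v) /\
  (forall v : 'I_q.+1 -> der, ~ free_at T p v).

Definition finitely_generated (T : der -> Prop) : Prop :=
  exists m (e : 'I_m -> der),
    forall v, T v <-> exists c : 'I_m -> A, v = \sum_(i < m) c i *: e i.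

(* Injectivity of N -> N^**, for N = Der / T: the linear forms on N are the
   linear forms on Der that vanish on T. *)
Definition torsionless_quotient (T : der -> Prop) : Prop :=
  forall v, (forall phi : {linear der -> A^o},
               (forall u, T u -> phi u = 0) -> phi v = 0) -> T v.

(* Germ of a foliation of codimension q on the germ of space with (reduced)
   local ring A. A coherent subsheaf of the tangent sheaf is determined near
   the point by its stalk, a finitely generated submodule of Der; the rank of
   the quotient is the rank at the generic point of every irreducible
   component, i.e. at every minimal prime of A. *)
Record foliation (q : nat) (T : der -> Prop) : Prop := Foliation {
  fol_coherent : finitely_generated T;
  fol_involutive : forall v w, T v -> T w -> T (lie_bracket v w);
  fol_torsionless : torsionless_quotient T;
  fol_rank : forall p, is_minimal_prime p -> quotient_rank_at T p q }.

Definition is_unit (a : A) : Prop := exists b, b * a = 1.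

(* Stalk of a log structure; the monoid is written additively. *)
Record log_structure := LogStructure {
  log_monoid :> nmodType;
  log_alpha : log_monoid -> A;
  log_alpha0 : log_alpha 0 = 1;
  log_alphaD : forall a b, log_alpha (a + b) = log_alpha a * log_alpha b;
  log_units : forall u, is_unit u -> exists! a, log_alpha a = u }.

(* The log structure is the one associated with the prelog structure
   log_alpha \o beta, where beta : N^r -> M: every element of M is the sum of
   some beta m and a unit a of M, and (m, a), (m', a') have the same sum only if
   they agree in the pushout of N^r and A^* over (log_alpha \o beta)^-1(A^* ). *)
Definition is_chart (M : log_structure) (r : nat) (beta : 'X_{1..r} -> M) : Prop :=
  let ab m := log_alpha (beta m) in
  [/\ beta 0%MM = 0,
      forall m m', beta (m + m')%MM = beta m + beta m',
      forall x : M, exists m (a : M), is_unit (log_alpha a) /\ x = beta m + a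
    & forall m m' (a a' : M), is_unit (log_alpha a) -> is_unit (log_alpha a') ->
        beta m + a = beta m' + a' ->
        exists l l', [/\ is_unit (ab l), is_unit (ab l'), (m + l = m' + l')%MM
                      & log_alpha a * ab l' = log_alpha a' * ab l]].

End Derivations.

Section LogPoint.
Variables (K : numFieldType) (A : comPzRingType) (k : K -> A).

(* Morphism from (X, M) to the standard log point, whose log structure is
   N (+) K^* -> K, (m, c) |-> c * 0 ^ m. *)
Record to_log_point (M : log_structure A) := ToLogPoint {
  flat : nat -> K -> M;
  flat0 : flat 0 1 = 0;
  flatD : forall m m' c c', c != 0 -> c' != 0 ->
    flat (m + m') (c * c') = flat m c + flat m' c';
  flat_alpha : forall m c, c != 0 -> log_alpha (flat m c) = k (c * 0 ^+ m) }.

Definition log_derivation (M : log_structure A) (f : to_log_point M)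
    (v : der k) (delta : M -> A) : Prop :=
  [/\ forall a b, delta (a + b) = delta a + delta b,
      forall a, log_alpha a * delta a = v (log_alpha a)
    & forall m c, c != 0 -> delta (flat f m c) = 0].

End LogPoint.

Section NormalCrossings.
Variables (K : numFieldType) (n r : nat).

(* Local ring at 0 of X = V(x_1 ... x_r) in (K^n, 0). *)
Definition nc_eqn : holo K n := \prod_(i < n | (i < r)%N) var K i.
Definition nc := quo nc_eqn.
Definition nc_const (c : K) : nc := cls nc_eqn (const n c).
Definition nc_var (i : 'I_n) : nc := cls nc_eqn (var K i).

(* The log structure is taken at 0, where all r components meet; the chart N^r
   at 0 determines it on a neighbourhood. *)
Definition semistable_map (M : log_structure nc) (f : to_log_point nc_const M) : Prop :=
  exists beta : 'X_{1..r} -> M,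
    [/\ is_chart beta,
        forall m, beta [multinom m | _ < r] = flat f m 1
      & forall (i : 'I_r) (k : 'I_n), i = k :> nat ->
          exists2 u, is_unit u & log_alpha (beta U_(i)%MM) * u = nc_var k].

Definition semistable (T : der nc_const -> Prop) : Prop :=
  exists (M : log_structure nc) (f : to_log_point nc_const M),
    semistable_map f /\
    forall v, T v -> exists delta, log_derivation f v delta.

(* v |-> w under T_X -> T_(X_i). *)
Definition der_restr (i : 'I_n) (v : der nc_const) (w : der (@const K n.-1)) : Prop :=
  forall f g : holo K n,
    v (cls nc_eqn f) = cls nc_eqn g -> w (restr i f) = restr i g.

(* Saturation in T_(X_i) of the image of T. *)
Definition fol_restr (T : der nc_const -> Prop) (i : 'I_n)
    (w : der (@const K n.-1)) : Prop :=
  exists s : holo K n.-1, s != 0 /\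
    exists2 v, T v & der_restr i v (s *: w).

(* Equation in X_i of D_i = X_i :&: \bigcup_(k != i) X_k. *)
Definition boundary_eqn (i : 'I_n) : holo K n.-1 :=
  restr i (\prod_(k < n | (k < r)%N && (k != i)) var K k).

End NormalCrossings.

Section SmoothGerm.
Variables (K : numFieldType) (m : nat).
Implicit Types (G : der (@const K m) -> Prop) (y h : holo K m).

(* The 1-form \sum_k omega_k dx_k on (K^m, 0). *)
Implicit Types omega eta : 'I_m -> holo K m.

Definition invariant_hypersurface G y : Prop :=
  forall w, G w -> forall a, exists b, w (a * y) = b * y.

(* The zero locus has codimension at least 2: every prime ideal that contains
   all coefficients has height at least 2. *)
Definition zero_codim_ge2 omega : Prop :=
  forall p : holo K m -> Prop, is_prime_ideal p -> (forall k, p (omega k)) ->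
    exists p0 p1 : holo K m -> Prop,
      [/\ is_prime_ideal p0, is_prime_ideal p1,
          forall a, p0 a -> p1 a, forall a, p1 a -> p a
        & (exists2 a, p1 a & ~ p0 a) /\ (exists2 a, p a & ~ p1 a)].

Definition defined_by G omega : Prop :=
  zero_codim_ge2 omega /\
  forall w, G w <-> \sum_(k < m) omega k * w (var K k) = 0.

(* Pullback of functions and forms along gamma : (K, 0) -> (K^m, 0). Since the
   gamma_k vanish at 0, only the monomials of degree at most mdeg t contribute
   to the coefficient of t. *)
Definition pullback (gamma : 'I_m -> holo K 1) (f : fps K m) : fps K 1 :=
  FPS (fun t => \sum_(a : 'X_{1..m < (mdeg t).+1})
                  f a * (\prod_(k < m) (gamma k : fps K 1) ^+ (a k)) t).

Definition pullback_form (gamma : 'I_m -> holo K 1) omega : fps K 1 :=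
  \sum_(k < m) pullback gamma (omega k) * fps_deriv ord0 (gamma k).

Definition tangent (gamma : 'I_m -> holo K 1) (k : 'I_m) : K :=
  gamma k U_(ord0)%MM.

Definition smooth_curve_in y (gamma : 'I_m -> holo K 1) : Prop :=
  [/\ forall k, gamma k 0%MM = 0, exists k, tangent gamma k != 0
    & pullback gamma y = 0].

End SmoothGerm.

(* Residue at t = 0 of the meromorphic form (a / b) dt: if b = t^p * u with u
   invertible, the coefficient of t^(p-1) in a / u. *)
Definition is_residue (K : numFieldType) (a b : fps K 1) (c : K) : Prop :=
  exists p (u u' : fps K 1),
    [/\ b = fps_var K ord0 ^+ p * u, u * u' = 1
      & c = if p is p'.+1 then (a * u') [multinom p' | _ < 1] else 0].

(* c is the Camacho-Sad index at 0, along the smooth hypersurface Y = {y = 0},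
   of the foliation defined by omega. A smooth curve germ in Y is generic when
   its tangent direction avoids some proper algebraic subset {P = 0} of T_0 Y. *)
Definition is_CS_index (K : numFieldType) m (omega : 'I_m -> holo K m)
    (y : holo K m) (c : K) : Prop :=
  exists (h : holo K m) (eta : 'I_m -> holo K m),
    [/\ forall k, omega k =
          (h : fps K m) * fps_deriv k y + (y : fps K m) * eta k :> fps K m,
        ~ (exists g, h = g * y)
      & exists P : {mpoly K[m]},
          (exists2 v : 'I_m -> K, \sum_(k < m) fps_deriv k y 0%MM * v k = 0
             & P.@[v] != 0) /\
          forall gamma, smooth_curve_in y gamma -> P.@[tangent gamma] != 0 ->
            is_residue (pullback_form gamma eta) (pullback gamma h) c].

(* Main.v *)
Require Import Defs.
From HB Require Import structures.
From mathcomp Require Import all_boot all_order all_algebra.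
From mathcomp Require Import boolp reals complex mpoly ring.

Set Implicit Arguments.
Unset Strict Implicit.
Unset Printing Implicit Defensive.

Import Order.TTheory GRing.Theory Num.Theory.
Local Open Scope ring_scope.

(** Write G_i for the saturated restriction of T to the component X_i, defined
    by the 1-form omega_i.  Invariance of D_i makes x_m divide every coefficient
    of omega_i except the one of dx_m, for every component X_m with m <> i
    ([omega_divides]), and as the zero locus of omega_i has codimension two, x_j
    does not divide the coefficient h_i of dx_j ([omega_ndvd]).  So omega_i is
    h_i dx_j + x_j eta_i, and the index of G_i along X_i and X_j is the residue
    of eta_i / h_i.

    The link between G_i and G_j comes from the torsion-less quotient: a
    derivation of the local ring of X belongs to T as soon as each of its
    restrictions to the components belongs, up to a nonzero factor, to the
    restriction of T ([mem_of_restrictions]).  For every coordinate x_k other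
    than x_i and x_j, the field

      h_i h_j d/dx_k - x_j eta_(i,k) h_j d/dx_j - x_i eta_(j,k) h_i d/dx_i

    restricts on X_i to a multiple of a field killed by omega_i, on X_j to a
    multiple of a field killed by omega_j, and on the other components to zero.
    Hence it lies in T ([glue_in_T]), so it is a relative logarithmic derivation
    for the semistable structure.  This means that its logarithmic derivatives
    of x_1, ..., x_r add up to that of a unit ([semistable_relation]).  On the
    intersection of X_i and X_j this sum is

      - h_j eta_(i,k) - h_i eta_(j,k) + h_i h_j / x_k,

    with the last term present only when X_k is a component.  Dividing by
    h_i h_j gives there

      eta_i / h_i + eta_j / h_j = sum of the dx_k / x_k - (holomorphic form),

    the sum being over the r - 2 other components.  Along a line through 0 the
    right-hand side has residue r - 2 ([stratum_identity], [residue_sum]).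

    It remains to see that the residue of eta_i / h_i is the same along all
    generic curves ([residue_curve_independent]).  Involutivity of T makes the
    form closed on x_j = 0 ([eta_closed]).  A generic curve is joined to a fixed
    line by an affine homotopy with parameter s.  As the form is closed, the
    s-derivative of its pullback is an exact form in the curve parameter, so it
    has no residue, and the residue does not depend on s.  All this is done with
    formal series whose coefficients are polynomials in s, because the leading
    coefficient of h_i along the homotopy is a polynomial in s that may vanish
    for some values of s. *)

(** * Formal power series *)

Section Series.
Variables (L : comNzRingType) (n : nat).
Implicit Types (f g h : fps L n) (m : 'X_{1..n}).

Lemma fpsDE f g m : (f + g) m = f m + g m. Proof. by []. Qed.
Lemma fpsNE f m : (- f) m = - f m. Proof. by []. Qed.
Lemma fps0E m : (0 : fps L n) m = 0. Proof. exact: mul0rn. Qed.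
Lemma fps1E m : (1 : fps L n) m = (m == 0%MM)%:R. Proof. by []. Qed.

Lemma fps_sumE (I : Type) (r : seq I) (P : pred I) (F : I -> fps L n) m :
  (\sum_(i <- r | P i) F i) m = \sum_(i <- r | P i) F i m.
Proof. by elim/big_rec2: _ => [|i y1 y2 _ <-]; rewrite ?fps0E. Qed.

Lemma fpsME d f g m : (mdeg m < d)%N ->
  (f * g) m = (fps_trunc d f * fps_trunc d g)@_m.
Proof. exact: fps_mulE. Qed.

Lemma fpsM_low f f' g g' m :
  (forall k, (mdeg k <= mdeg m)%N -> f k = f' k) ->
  (forall k, (mdeg k <= mdeg m)%N -> g k = g' k) ->
  (f * g) m = (f' * g') m.
Proof.
move=> hf hg; rewrite !(@fpsME (mdeg m).+1) //; apply: mcoeffM_low => k km.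
  by rewrite !fps_truncE ?ltnS ?hf.
by rewrite !fps_truncE ?ltnS ?hg.
Qed.

Lemma fpsM0 f g : (f * g) 0%MM = f 0%MM * g 0%MM.
Proof.
rewrite (@fpsME 1) ?mdeg0 // (mcoeff0_is_multiplicative _ _).1.
by rewrite !fps_truncE ?mdeg0.
Qed.

Lemma fpsX0 f e : (f ^+ e) 0%MM = f 0%MM ^+ e.
Proof. by elim: e => [|e IH]; rewrite ?expr0 ?fps1E ?eqxx // !exprS fpsM0 IH. Qed.

Lemma fps_const_zmod : zmod_morphism (@fps_const L n).
Proof. by move=> a b; apply: fpsP => m; rewrite /= mulrnBl. Qed.

Lemma fps_constM c f m : (fps_const n c * f) m = c * f m.
Proof.
rewrite (@fpsME (mdeg m).+1) // -[f m](@fps_truncE _ _ (mdeg m).+1) //.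
rewrite -mcoeffCM; apply: mcoeffM_low => // k km.
by rewrite fps_truncE ?ltnS // mcoeffC mulr_natr.
Qed.

Lemma fps_const_monoid : monoid_morphism (@fps_const L n).
Proof.
split=> // a b; apply: fpsP => m.
by rewrite fps_constM /= mulrnAr.
Qed.

HB.instance Definition _ :=
  GRing.isZmodMorphism.Build L (fps L n) (@fps_const L n) fps_const_zmod.
HB.instance Definition _ :=
  GRing.isMonoidMorphism.Build L (fps L n) (@fps_const L n) fps_const_monoid.

Lemma fps_varM (i : 'I_n) f m :
  (fps_var L i * f) m = if (0 < m i)%N then f (m - U_(i))%MM else 0.
Proof.
have vE : ('X_i * fps_trunc (mdeg m).+1 f)@_m = (fps_var L i * f) m.
  rewrite (@fpsME (mdeg m).+1) //; apply: mcoeffM_low => // k km.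
  by rewrite fps_truncE ?ltnS // mcoeffX eq_sym.
rewrite -vE; case: ifP => mi.
  have em : m = (m - U_(i) + U_(i))%MM.
    by rewrite submK //; apply/mnm_lepP => k; rewrite mnm1E; case: eqP => // <-.
  have -> (p : {mpoly L[n]}) : ('X_i * p)@_m = p@_(m - U_(i)).
    by rewrite -(mcoeffMX p U_(i)%MM) addmC -em mulrC.
  by rewrite fps_truncE // ltnS mdegB.
rewrite mcoeffM big1 // => -[k l] /= /eqP e.
rewrite mcoeffX; case: eqP => [ek|]; last by rewrite mul0r.
by move: (congr1 (fun k : 'X_{1..n} => k i) e) mi; rewrite mnmDE -ek mnm1E eqxx => ->.
Qed.

Lemma fps_varX (i : 'I_n) e f m :
  (fps_var L i ^+ e * f) m = if (e <= m i)%N then f (m - U_(i) *+ e)%MM else 0.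
Proof.
elim: e m => [|e IH] m; first by rewrite mul1r mulm0n subm0.
rewrite exprS -mulrA fps_varM IH mnmBE mnm1E eqxx.
case: ltnP => mi; last first.
  by move: mi; rewrite leqn0 => /eqP ->.
rewrite leq_subRL // add1n; case: ifP => // _.
by rewrite mulmS submDA.
Qed.

Lemma fps_derivD (i : 'I_n) f g :
  fps_deriv i (f + g) = fps_deriv i f + fps_deriv i g.
Proof. by apply: fpsP => m; rewrite /= mulrnDl. Qed.

Lemma fps_derivM (i : 'I_n) f g :
  fps_deriv i (f * g) = f * fps_deriv i g + g * fps_deriv i f.
Proof.
apply: fpsP => m; rewrite -[LHS]/((f * g) (m + U_(i))%MM *+ (m i).+1) fpsDE.
have md : (mdeg (m + U_(i))%MM < (mdeg m).+2)%N by rewrite mdegD mdeg1 addn1.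
rewrite (fpsME _ _ md) -mcoeff_deriv mderivM mcoeffD addrC (mulrC g).
rewrite !(@fpsME (mdeg m).+1) //.
congr (_ + _); apply: mcoeffM_low => k km.
all: rewrite ?mcoeff_deriv !fps_truncE ?ltnS ?mdegD ?mdeg1 ?addn1 ?ltnS //.
all: by rewrite (leq_trans km).
Qed.

Lemma fps_derivC (i : 'I_n) (c : L) : fps_deriv i (fps_const n c) = 0.
Proof.
apply: fpsP => m; rewrite fps0E /= mnmD_eq0 -(mdeg_eq0 U_(i)%MM) mdeg1 andbF.
by rewrite mulr0n mul0rn.
Qed.

Lemma fps_deriv_var (i k : 'I_n) : fps_deriv i (fps_var L k) = (k == i)%:R.
Proof.
apply: fpsP => m /=; have -> : (k == i)%:R = fps_const n (k == i)%:R :> fps L n.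
  by rewrite rmorph_nat.
rewrite /=; have [<-|ki] := eqVneq k i.
  rewrite -[X in _ == X]add0m eqm_add2r; case: eqP => [->|_]; first by rewrite mnm0E.
  by rewrite mulr0n mul0rn.
case: eqP => [/mnmP/(_ i)|_]; last by rewrite mulr0n !mul0rn.
by rewrite mnmDE !mnm1E eqxx (negPf ki) addn1.
Qed.

End Series.

(** * Series in one variable *)

Section OneVariable.
Variable L : comNzRingType.
Implicit Types (f g : fps L 1) (d e : nat).

Definition expt d : 'X_{1..1} := [multinom d | _ < 1].

Notation tvar := (fps_var L (ord0 : 'I_1)).

Lemma exptE (m : 'X_{1..1}) : m = expt (mdeg m).
Proof. by apply/mnmP => i; rewrite mdegE big_ord1 mnmE ord1. Qed.

Lemma mdeg_expt d : mdeg (expt d) = d.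
Proof. by rewrite mdegE big_ord1 mnmE. Qed.

Lemma expt0 : expt 0 = 0%MM.
Proof. by apply/mnmP => i; rewrite !mnmE. Qed.

Lemma fps1P f g : (forall d, f (expt d) = g (expt d)) -> f = g.
Proof. by move=> h; apply: fpsP => m; rewrite (exptE m). Qed.

Lemma tXE e f d :
  (tvar ^+ e * f) (expt d) = if (e <= d)%N then f (expt (d - e)) else 0.
Proof.
rewrite fps_varX mnmE; case: ifP => // ed; congr (f _).
by apply/mnmP => i; rewrite mnmBE mulmnE mnm1E !mnmE (ord1 i) mul1n.
Qed.

Lemma tM0 f : (tvar * f) (expt 0) = 0.
Proof. exact: (tXE 1 f 0). Qed.

Lemma tMS f d : (tvar * f) (expt d.+1) = f (expt d).
Proof. by have := tXE 1 f d.+1; rewrite subn1. Qed.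

Lemma fps_natM k f m : (k%:R * f) m = f m *+ k.
Proof. by rewrite -(rmorph_nat (@fps_const L 1)) fps_constM mulr_natl. Qed.

Lemma tXI e : injective ( *%R (tvar ^+ e)).
Proof.
move=> f g efg; apply: fps1P => d.
have : (tvar ^+ e * f) (expt (d + e)) = (tvar ^+ e * g) (expt (d + e)).
  by rewrite (efg : tvar ^+ e * f = _).
by rewrite !tXE leq_addl addnK.
Qed.

Lemma tderivE f d :
  fps_deriv ord0 f (expt d) = f (expt d.+1) *+ d.+1.
Proof.
rewrite /= mnmE; congr (f _ *+ _); apply/mnmP => i.
by rewrite mnmDE mnm1E !mnmE (ord1 i) addn1.
Qed.

Definition tshift e f : fps L 1 := FPS (fun m => f (expt (e + mdeg m))).

Lemma tshiftE e f : (forall d, (d < e)%N -> f (expt d) = 0) ->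
  f = tvar ^+ e * tshift e f.
Proof.
move=> f0; apply: fps1P => d; rewrite tXE /= mdeg_expt.
by case: leqP => [/subnKC ->|/f0].
Qed.

Lemma tX_low e f m : (mdeg m < e)%N -> (tvar ^+ e * f) m = 0.
Proof. by move=> de; rewrite (exptE m) tXE leqNgt de. Qed.

End OneVariable.

Notation tvar := (fps_var _ (ord0 : 'I_1)).

(** The inverse is a geometric series in the series e without constant term
    below; each coefficient only involves finitely many of its terms. *)
Lemma fps_inv (F : fieldType) (f : fps F 1) : f 0%MM != 0 ->
  exists g, f * g = 1.
Proof.
move=> f0; pose c := fps_const 1 (f 0%MM)^-1; pose e := 1 - c * f.
have e0 : e = tvar ^+ 1 * tshift 1 e.
  apply: tshiftE => -[|//] _; rewrite expt0 /e fpsDE fpsNE fps1E fps_constM.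
  by rewrite eqxx mulVf // subrr.
have elow d m : (mdeg m < d)%N -> (e ^+ d) m = 0.
  by rewrite e0 exprMn -exprM mul1n; apply: tX_low.
pose s d := \sum_(i < d) e ^+ i.
pose g : fps F 1 := FPS (fun m => s (mdeg m).+1 m).
have sE d k : (mdeg k < d)%N -> g k = s d k.
  move=> kd; rewrite -[g k]/(s (mdeg k).+1 k) -(subnKC kd) {2}/s.
  rewrite big_split_ord fpsDE -[LHS]addr0; congr (_ + _); rewrite fps_sumE big1 // => i _.
  by apply: elow; rewrite ltnS leq_addr.
have se d : (1 - e) * s d = 1 - e ^+ d by rewrite -[LHS]opprK -mulNr opprB -subrX1 opprB.
exists (c * g); rewrite mulrA (mulrC f).
have -> : c * f = 1 - e by rewrite /e opprB addrC subrK.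
apply: fpsP => m.
rewrite (@fpsM_low _ _ _ (1 - e) _ (s (mdeg m).+1)) // => [|k km]; last first.
  by rewrite (@sE (mdeg m).+1).
by rewrite se fpsDE fpsNE elow ?subr0.
Qed.

(** * Change of coefficients *)

Section MapSeries.
Variables (K L : comNzRingType) (phi : {rmorphism K -> L}) (n : nat).

Definition map_fps (f : fps K n) : fps L n := FPS (fun m => phi (f m)).

Lemma map_fps_zmod : zmod_morphism map_fps.
Proof. by move=> f g; apply: fpsP => m; rewrite /= rmorphB. Qed.

Lemma map_fps_monoid : monoid_morphism map_fps.
Proof.
split=> [|f g]; apply: fpsP => m; first by rewrite /= rmorphMn rmorph1.
rewrite /= rmorph_sum; apply: eq_bigr => k _; exact: rmorphM.
Qed.

HB.instance Definition _ :=
  GRing.isZmodMorphism.Build (fps K n) (fps L n) map_fps map_fps_zmod.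
HB.instance Definition _ :=
  GRing.isMonoidMorphism.Build (fps K n) (fps L n) map_fps map_fps_monoid.

Lemma map_fps_const c : map_fps (fps_const n c) = fps_const n (phi c).
Proof. by apply: fpsP => m; rewrite /= rmorphMn. Qed.

Lemma map_fps_var i : map_fps (fps_var K i) = fps_var L i.
Proof. by apply: fpsP => m; rewrite /= rmorph_nat. Qed.

Lemma map_fps_deriv i f :
  map_fps (fps_deriv i f) = fps_deriv i (map_fps f).
Proof. by apply: fpsP => m; rewrite /= rmorphMn. Qed.

End MapSeries.
Arguments map_fps {K L} phi {n} f.

(** * Substitution of a formal arc *)

Section Substitution.
Variables (K L : comNzRingType) (iota : {rmorphism K -> L}) (m : nat).
Implicit Types (f g : fps K m) (gam : 'I_m -> fps L 1).

(** The series f o gam, for an arc gam through 0. Only the monomials of degree at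
    most d contribute to the coefficient of t^d, whence the finite sum; [iota]
    allows the arc to have coefficients in a larger ring than f. *)
Definition fsub gam f : fps L 1 :=
  FPS (fun t => \sum_(a : 'X_{1..m < (mdeg t).+1})
                  iota (f a) * (\prod_(k < m) gam k ^+ a k) t).

Notation psub gam := (mmap (@fps_const L 1 \o iota) gam).

Variable gam : 'I_m -> fps L 1.
Hypothesis gam0 : forall k, gam k 0%MM = 0.

Lemma arc_monomial (a : 'X_{1..m}) : exists2 g : fps L 1,
  \prod_(k < m) gam k ^+ a k = tvar ^+ mdeg a * g &
  g 0%MM = \prod_(k < m) gam k U_(ord0)%MM ^+ a k.
Proof.
have gamE k : gam k = tvar ^+ 1 * tshift 1 (gam k).
  by apply: tshiftE => -[|//] _; rewrite expt0.
exists (\prod_(k < m) tshift 1 (gam k) ^+ a k); last first.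
  have one0 : (1 : fps L 1) 0%MM = 1 by rewrite fps1E eqxx.
  rewrite (big_morph (fun g : fps L 1 => g 0%MM) (@fpsM0 _ _) one0).
  apply: eq_bigr => k _; rewrite fpsX0 /= mdeg0; congr (gam k _ ^+ _).
  by rewrite [RHS]exptE mdeg1.
under eq_bigr do rewrite gamE exprMn -exprM mul1n.
by rewrite big_split /= prodrXr -mdegE.
Qed.

Lemma psub_low (p : {mpoly K[m]}) t :
  (forall a, (mdeg a <= mdeg t)%N -> p@_a = 0) -> psub gam p t = 0.
Proof.
move=> p0; rewrite /mmap fps_sumE big1 // => a _.
rewrite fps_constM.
have [at_|ta] := leqP (mdeg a) (mdeg t); first by rewrite p0 // rmorph0 mul0r.
by have [g eg _] := arc_monomial a; rewrite /mmap1 eg tX_low ?mulr0.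
Qed.

Lemma fsub_trunc d f t : (mdeg t < d)%N ->
  fsub gam f t = psub gam (fps_trunc d f) t.
Proof.
move=> td; transitivity (psub gam (fps_trunc (mdeg t).+1 f) t); last first.
  apply/eqP; rewrite -subr_eq0 -fpsNE -fpsDE -rmorphB /=; apply/eqP.
  apply: psub_low => a ta; rewrite mcoeffB !fps_truncE ?subrr // ?ltnS //.
  exact: leq_ltn_trans td.
have sz : (msize (fps_trunc (mdeg t).+1 f) <= (mdeg t).+1)%N.
  rewrite msizeE; apply/bigmax_leqP_seq => a; rewrite mcoeff_msupp => pa _.
  rewrite ltnNge; apply: contraNN pa => ta.
  rewrite /fps_trunc raddf_sum big1 // => b _; rewrite /= mcoeffZ mcoeffX.
  case: eqP => [ba|_]; last by rewrite mulr0.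
  by have := bmdeg b; rewrite ba ltnNge ta.
rewrite (mmapE _ sz) fps_sumE; apply: eq_bigr => a _.
by rewrite fps_constM fps_truncE ?bmdeg.
Qed.

Lemma fsubB f g : fsub gam (f - g) = fsub gam f - fsub gam g.
Proof.
apply: fpsP => t; rewrite fpsDE fpsNE /= -sumrB; apply: eq_bigr => a _.
by rewrite rmorphB mulrBl.
Qed.

Lemma fsub0 : fsub gam 0 = 0.
Proof. by rewrite -[0](subrr 0) fsubB subrr. Qed.

Lemma fsubD f g : fsub gam (f + g) = fsub gam f + fsub gam g.
Proof. by rewrite -{1}(opprK g) -[- g]sub0r !fsubB fsub0 sub0r opprK. Qed.

Lemma psub_eq (p q : {mpoly K[m]}) t :
  (forall a, (mdeg a <= mdeg t)%N -> p@_a = q@_a) -> psub gam p t = psub gam q t.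
Proof.
move=> pq; apply/eqP; rewrite -subr_eq0 -fpsNE -fpsDE -rmorphB /=; apply/eqP.
by apply: psub_low => a ta; rewrite mcoeffB pq ?subrr.
Qed.

Lemma fsubM f g : fsub gam (f * g) = fsub gam f * fsub gam g.
Proof.
apply: fpsP => t; pose d := (mdeg t).+1.
rewrite (@fsub_trunc d) //.
transitivity ((psub gam (fps_trunc d f) * psub gam (fps_trunc d g)) t).
  rewrite -rmorphM; apply: psub_eq => a ta.
  by rewrite fps_truncE ?ltnS // (@fpsME _ _ d) ?ltnS.
by apply: fpsM_low => k kt; rewrite (@fsub_trunc d) ?ltnS.
Qed.

Lemma fsub_var i : fsub gam (fps_var K i) = gam i.
Proof.
apply: fpsP => t; rewrite (@fsub_trunc (mdeg t).+1) //.
have <- : psub gam 'X_i = gam i by rewrite mmapX mmap1U.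
by apply: psub_eq => a ta; rewrite fps_truncE ?ltnS // mcoeffX eq_sym.
Qed.

(** The chain rule holds for every derivation of the series ring that kills the
    constants and lowers the order by at most one; it is used both for the
    derivative along an arc and for the derivative in a parameter on which the
    arc depends. *)
Lemma chain_rule (D : fps L 1 -> fps L 1) :
  (forall f g : fps L 1, D (f + g) = D f + D g) ->
  (forall f g : fps L 1, D (f * g) = f * D g + g * D f) ->
  (forall c, D (fps_const 1 (iota c)) = 0) ->
  (forall (f g : fps L 1) t, (forall k, (mdeg k <= (mdeg t).+1)%N -> f k = g k) ->
     D f t = D g t) ->
  forall f, D (fsub gam f) = \sum_(i < m) fsub gam (fps_deriv i f) * D (gam i).
Proof.
move=> DD DM DC Dlow f; have D0 : D 0 = 0.
  by apply: (addrI (D 0)); rewrite -DD !addr0.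
have D1 : D 1 = 0 by rewrite -[1]/(fps_const 1 1) -[in LHS](rmorph1 iota) DC.
pose Q (p : {mpoly K[m]}) :=
  D (psub gam p) = \sum_(i < m) psub gam p^`M(i) * D (gam i).
have QM p q : Q p -> Q q -> Q (p * q).
  rewrite /Q rmorphM DM => -> ->; rewrite !mulr_sumr -big_split /=.
  apply: eq_bigr => i _; rewrite mderivM rmorphD !rmorphM mulrDl /=.
  by rewrite addrC !mulrA [in X in X + _](mulrC (psub gam q)).
have QC c : Q c%:MP.
  rewrite /Q mmapC /= DC big1 // => i _.
  by rewrite mderivC rmorph0 mul0r.
have QX i : Q 'X_i.
  rewrite /Q mmapX mmap1U (bigD1 i) //= mderivX mnm1E eqxx scale1r -{1}[U_(i)%MM]add0m addmK.
  rewrite mpolyX0 rmorph1 mul1r big1 ?addr0 // => k ki.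
  by rewrite mderivX mnm1E eq_sym (negPf ki) scale0r rmorph0 mul0r.
have Qp p : Q p.
  elim/mpolyind: p => [|c a p _ _ IH]; first by rewrite -mpolyC0.
  have Qa : Q (c *: 'X_[a]).
    rewrite -mul_mpolyC mpolyXE_id; apply: (QM) => //.
    elim/big_ind: _ => [||i _]; [by rewrite -mpolyC1|by exact: QM|].
    elim: (a i) => [|e IHe]; first by rewrite expr0 -mpolyC1.
    by rewrite exprS; apply: (QM).
  rewrite /Q rmorphD DD Qa IH -big_split; apply: eq_bigr => i _.
  by rewrite mderivD rmorphD mulrDl.
apply: fpsP => t; pose p := fps_trunc (mdeg t).+2 f.
rewrite (@Dlow _ (psub gam p)) => [|k kt]; last first.
  by rewrite (@fsub_trunc (mdeg t).+2) ?ltnS.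
rewrite Qp !fps_sumE; apply: eq_bigr => i _; apply: fpsM_low => // k kt.
rewrite (@fsub_trunc (mdeg t).+1) ?ltnS //; apply: psub_eq => a ak.
have at_ := leq_trans ak kt.
by rewrite mcoeff_deriv !fps_truncE ?mdegD ?mdeg1 ?addn1 ?ltnS.
Qed.

End Substitution.

(** * Residues of closed forms *)

Section ParameterDerivative.
Variable K : comNzRingType.
Implicit Types f g : fps {poly K} 1.

(** The variable of the series is t, the variable of the polynomials is s. *)
Definition sder f : fps {poly K} 1 := FPS (fun t => (f t)^`()).

Lemma sderD f g : sder (f + g) = sder f + sder g.
Proof. by apply: fpsP => t; rewrite /= derivD. Qed.

Lemma sderM f g : sder (f * g) = f * sder g + g * sder f.
Proof.
rewrite (mulrC g); apply: fpsP => t; rewrite fpsDE /= raddf_sum -big_split /=.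
by apply: eq_bigr => k _; rewrite derivM addrC.
Qed.

Lemma sder_const c : sder (fps_const 1 c%:P) = 0.
Proof. by apply: fpsP => t; rewrite fps0E /= derivMn derivC mul0rn. Qed.

Lemma sder_low f g t :
  (forall k, (mdeg k <= (mdeg t).+1)%N -> f k = g k) -> sder f t = sder g t.
Proof. by move=> fg; rewrite /= fg. Qed.

Lemma sder_tderiv f : sder (fps_deriv ord0 f) = fps_deriv ord0 (sder f).
Proof. by apply: fpsP => t; rewrite /= derivMn. Qed.

End ParameterDerivative.

Lemma tderiv_low (L : comNzRingType) (f g : fps L 1) t :
  (forall k, (mdeg k <= (mdeg t).+1)%N -> f k = g k) ->
  fps_deriv ord0 f t = fps_deriv ord0 g t.
Proof. by move=> fg; rewrite /= fg // mdegD mdeg1 addn1. Qed.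

Lemma antisym_sum0 (V : zmodType) (I : finType) (F : I -> I -> V) :
  (forall x : V, x + x = 0 -> x = 0) -> (forall i k, F i k = - F k i) ->
  \sum_i \sum_k F i k = 0.
Proof.
move=> V2 Fa; apply: V2; rewrite [X in X + _]exchange_big -big_split /=.
apply: big1 => i _; rewrite -big_split big1 //= => k _.
by rewrite [F k i]Fa addNr.
Qed.

Section Family.
Variables (K : numFieldType) (m : nat) (j : 'I_m).
Variables (h : fps K m) (eta : 'I_m -> fps K m).

(* Closedness of the restriction of eta / h to x_j = 0, without denominators. *)
Hypothesis closed : forall k l, k != j -> l != j -> exists e,
  h * (fps_deriv l (eta k) - fps_deriv k (eta l)) =
  eta k * fps_deriv l h - eta l * fps_deriv k h + fps_var K j * e.

Variable Gam : 'I_m -> fps {poly K} 1.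
Hypothesis Gam0 : forall k, Gam k 0%MM = 0.
Hypothesis Gamj : Gam j = 0.

Local Notation S := (fsub (@polyC K) Gam).
Local Notation Dt := (@fps_deriv {poly K} 1 ord0).
Local Notation Ds := (@sder K).

Let a := \sum_(k < m) S (eta k) * Dt (Gam k).
Let e := \sum_(k < m) S (eta k) * Ds (Gam k).
Let b := S h.

Lemma fps_double0 (x : fps {poly K} 1) : x + x = 0 -> x = 0.
Proof.
move=> x0; apply: fpsP => t; have : (x + x) t = 0 by rewrite x0 fps0E.
rewrite fps0E fpsDE => /eqP; rewrite -mulr2n -mulr_natr mulf_eq0.
by rewrite -polyC_natr polyC_eq0 pnatr_eq0 orbF => /eqP.
Qed.

Lemma Dt_S f : Dt (S f) = \sum_(l < m) S (fps_deriv l f) * Dt (Gam l).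
Proof.
apply: chain_rule => //; [exact: fps_derivD|exact: fps_derivM| |].
  by move=> c; exact: fps_derivC.
exact: tderiv_low.
Qed.

Lemma Ds_S f : Ds (S f) = \sum_(l < m) S (fps_deriv l f) * Ds (Gam l).
Proof.
apply: chain_rule => //; [exact: sderD|exact: sderM| |exact: sder_low].
exact: sder_const.
Qed.

Lemma Dt0 : Dt 0 = 0.
Proof. by rewrite -[RHS](fps_derivC ord0 0) rmorph0. Qed.
Lemma Ds0 : Ds 0 = 0.
Proof. by rewrite -[RHS](sder_const 0) rmorph0. Qed.

Lemma Ds_sum (F : 'I_m -> fps {poly K} 1) : Ds (\sum_k F k) = \sum_k Ds (F k).
Proof. exact: (big_morph _ (@sderD K) Ds0). Qed.
Lemma Dt_sum (F : 'I_m -> fps {poly K} 1) : Dt (\sum_k F k) = \sum_k Dt (F k).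
Proof. exact: (big_morph _ (@fps_derivD _ _ ord0) Dt0). Qed.

(** Cartan's formula for the homotopy [Gam]: the s-derivative of the pullback
    (a / b) dt of the closed form eta / h is the t-derivative of e / b, where
    e / b is the value of the form on the velocity d Gam / ds. Both sides have
    been multiplied by b^2. *)
Lemma closed_pullback : b * (Ds a - Dt e) = a * Ds b - e * Dt b.
Proof.
(* A is antisymmetric and, by closedness, c is symmetric off the index j. *)
pose A k l := Ds (Gam l) * Dt (Gam k) - Dt (Gam l) * Ds (Gam k).
pose c k l := S h * S (fps_deriv l (eta k)) - S (eta k) * S (fps_deriv l h).
have -> : Ds a - Dt e = \sum_k \sum_l S (fps_deriv l (eta k)) * A k l.
  rewrite Ds_sum Dt_sum -sumrB; apply: eq_bigr => k _.
  rewrite sderM fps_derivM Ds_S Dt_S sder_tderiv.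
  rewrite opprD addrACA subrr add0r !mulr_sumr -sumrB; apply: eq_bigr => l _.
  by rewrite /A; ring.
have -> : a * Ds b - e * Dt b =
    \sum_k \sum_l S (eta k) * S (fps_deriv l h) * A k l.
  rewrite /b Ds_S Dt_S !mulr_suml -sumrB; apply: eq_bigr => k _.
  rewrite !mulr_sumr -sumrB; apply: eq_bigr => l _.
  by rewrite /A; ring.
apply/eqP; rewrite -subr_eq0 mulr_sumr -sumrB.
under eq_bigr do rewrite mulr_sumr -sumrB.
rewrite -[X in X == 0]/(\sum_k \sum_l _); apply/eqP.
transitivity (\sum_k \sum_l c k l * A k l).
  by apply: eq_bigr => k _; apply: eq_bigr => l _; rewrite /c /b; ring.
apply: antisym_sum0; first exact: fps_double0.
move=> k l; have [->|kj] := eqVneq k j.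
  by rewrite /A Gamj Dt0 Ds0; ring.
have [->|lj] := eqVneq l j.
  by rewrite /A Gamj Dt0 Ds0; ring.
have -> : c k l = c l k.
  have [x /(congr1 S)] := closed kj lj.
  rewrite fsubD !fsubM // !fsubB // !fsubM // fsub_var // Gamj mul0r addr0.
  rewrite /c => /eqP; rewrite -subr_eq0 => /eqP E.
  apply/eqP; rewrite -subr_eq0 -[X in _ == X]E; apply/eqP; ring.
by rewrite /A; ring.
Qed.

End Family.

Section LogWronskian.
Variable K : numFieldType.
Local Notation Dt := (@fps_deriv {poly K} 1 ord0).
Local Notation Ds := (@sder K).

Lemma tderiv_tX (L : comNzRingType) d (f : fps L 1) :
  tvar * fps_deriv ord0 (tvar ^+ d * f) =
  tvar ^+ d * (tvar * fps_deriv ord0 f + d%:R * f).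
Proof.
apply: fps1P => -[|e].
  rewrite tM0 tXE leqn0; case: eqP => // ->.
  by rewrite fpsDE tM0 mul0r fps0E addr0.
rewrite tMS tderivE !tXE; case: leqP => de; last by rewrite mul0rn.
rewrite fpsDE fps_natM; move: de; rewrite leq_eqVlt => /predU1P[<-|de].
  by rewrite subnn tM0 add0r.
rewrite subSn // tMS tderivE -mulrnDr.
by congr (_ *+ _); rewrite addSn subnK.
Qed.

Lemma sder_tX d (f : fps {poly K} 1) : Ds (tvar ^+ d * f) = tvar ^+ d * Ds f.
Proof.
apply: fps1P => e; rewrite -[LHS]/(((tvar ^+ d * f) (expt e))^`()) !tXE.
by case: ifP => // _; rewrite deriv0.
Qed.

(** The residue of a / b at t = 0 is p / q. The identity
    d/ds (a / b) = d/dt (e / b) says that its s-derivative is the residue of an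
    exact form, hence zero; the conclusion is this equation for the quotient
    p / q. Since q need not be invertible in K[s], the unit part u of b only has
    an inverse up to the factor q and modulo t^(nu+2), which is enough to read
    off the coefficient of t^nu. *)
Lemma log_wronskian (nu : nat) (a b e u u' r : fps {poly K} 1) (q : {poly K}) :
  b * (Ds a - Dt e) = a * Ds b - e * Dt b ->
  b = tvar ^+ nu.+1 * u ->
  u * u' = fps_const 1 q + tvar ^+ nu.+2 * r ->
  let p := (a * u') (expt nu) in p^`() * q = p * q^`().
Proof.
move=> E eb euu p; pose w := u * u'; pose f := a * u'; pose g := e * u'.
have Dsuu : Ds w = u * Ds u' + u' * Ds u by rewrite sderM.
have Dtuu : Dt w = u * Dt u' + u' * Dt u by rewrite fps_derivM.
(* The relation E divided by b and by t^nu; multiplying it by u'^2 gives E2, in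
   which u and u' only occur through w, f and g. *)
have E1 : tvar * (u * (Ds a - Dt e)) =
    tvar * (a * Ds u) - e * (tvar * Dt u + nu.+1%:R * u).
  apply: (@tXI _ nu.+1); rewrite /=.
  transitivity (tvar * (b * (Ds a - Dt e))); first by rewrite eb; ring.
  rewrite E mulrBr [X in _ - X]mulrCA eb tderiv_tX sder_tX; ring.
have E2 : tvar * (w * Ds f - f * Ds w) =
    tvar * (w * Dt g - g * Dt w) - nu.+1%:R * (w * g).
  rewrite Dsuu Dtuu /f /g !sderM !fps_derivM /w.
  have -> : tvar * (u * u' * (a * Ds u' + u' * Ds a) -
      a * u' * (u * Ds u' + u' * Ds u)) =
    u' * u' * (tvar * (u * (Ds a - Dt e)) - tvar * (a * Ds u))
      + tvar * (u' * u' * (u * Dt e)) by ring.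
  by rewrite E1; ring.
have wlow (x : fps {poly K} 1) d : (d < nu.+2)%N -> (w * x) (expt d) = q * x (expt d).
  move=> dnu; rewrite /w euu mulrDl fpsDE fps_constM -mulrA.
  by rewrite tX_low ?addr0 ?mdeg_expt.
have := congr1 (fun x : fps {poly K} 1 => x (expt nu.+1)) E2.
have wD (D : fps {poly K} 1 -> fps {poly K} 1) (x : fps {poly K} 1) c :
    (forall k, (k <= nu)%N -> D w (expt k) = (k == 0%N)%:R * c) ->
  (x * D w) (expt nu) = x (expt nu) * c.
  move=> h; rewrite mulrC -[RHS]mulrC -fps_constM; apply: fpsM_low => // k.
  rewrite mdeg_expt => kn; rewrite (exptE k) h // mulr_natl /=.
  by congr (_ *+ _); rewrite -mdeg_eq0 mdeg_expt.
have wE k : (k < nu.+2)%N -> w (expt k) = q *+ (k == 0%N).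
  move=> kn; rewrite -[w]mulr1 wlow // fps1E mulr_natr; congr (_ *+ _).
  by rewrite -mdeg_eq0 mdeg_expt.
have -> : (tvar * (w * Ds f - f * Ds w)) (expt nu.+1) = q * p^`() - p * q^`().
  rewrite tMS fpsDE fpsNE wlow // (wD Ds f q^`()) // => k kn.
  by rewrite -[LHS]/((w (expt k))^`()) wE ?derivMn ?mulr_natl // ltnS leqW.
have -> : (tvar * (w * Dt g - g * Dt w) - nu.+1%:R * (w * g)) (expt nu.+1) = 0.
  rewrite fpsDE fpsNE tMS fpsDE fpsNE wlow // (wD Dt g 0) => [|k kn]; last first.
    by rewrite tderivE wE // mulr0n mul0rn mulr0.
  by rewrite fps_natM wlow // tderivE mulr0 subr0 mulrnAr subrr.
by move/eqP; rewrite subr_eq0 mulrC => /eqP.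
Qed.

(** In characteristic 0 two polynomials with zero Wronskian are proportional;
    the coefficients of the defect vanish one after the other because q does not
    vanish at 0. *)
Lemma wronskian0_prop (p q : {poly K}) :
  p^`() * q = p * q^`() -> q.[0] != 0 -> p * (q.[0])%:P = q * (p.[0])%:P.
Proof.
move=> E q0; pose w := p * (q.[0])%:P - q * (p.[0])%:P.
have Ew : w^`() * q = w * q^`().
  rewrite /w derivB !derivM !derivC !mulr0 !addr0 mulrBl mulrBl.
  by rewrite mulrAC E; ring.
suff w0 n : w`_n = 0.
  by apply/eqP; rewrite -subr_eq0; apply/eqP/polyP => n; rewrite w0 coef0.
elim/ltn_ind: n => -[_|n IH].
  by rewrite -horner_coef0 /w !hornerE mulrC subrr.
have := congr1 (fun x : {poly K} => x`_n) Ew.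
rewrite !coefM big_ord_recr /= subnn big1 => [|k _]; last first.
  by rewrite coef_deriv IH ?mul0rn ?mul0r // ltnS.
rewrite big1 => [|k _]; last by rewrite IH ?mul0r // ltn_ord.
rewrite add0r coef_deriv -horner_coef0 => /eqP.
by rewrite mulf_eq0 (negPf q0) orbF mulrn_eq0 => /eqP.
Qed.

End LogWronskian.

(** * Independence of the curve *)

Lemma map_fsub (K L M : comNzRingType) (iota : {rmorphism K -> L})
    (phi : {rmorphism L -> M}) (iota' : {rmorphism K -> M}) m
    (gam : 'I_m -> fps L 1) (f : fps K m) :
  (forall c, phi (iota c) = iota' c) ->
  map_fps phi (fsub iota gam f) = fsub iota' (fun k => map_fps phi (gam k)) f.
Proof.
move=> phi_iota; apply: fpsP => t; rewrite /= rmorph_sum; apply: eq_bigr => a _.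
rewrite rmorphM phi_iota; congr (_ * _).
rewrite -[LHS]/(map_fps phi (\prod_(k < m) gam k ^+ a k) t) rmorph_prod.
by under eq_bigr do rewrite rmorphXn.
Qed.

Definition lead_form (K : comNzRingType) m (j : 'I_m) nu (h : fps K m) :
    {mpoly K[m]} :=
  \sum_(a : 'X_{1..m < nu.+1} | (mdeg a == nu) && (a j == 0%N)) h a *: 'X_[a].

(** Along an arc in x_j = 0 a monomial of degree d only contributes from t^d on,
    and a monomial containing x_j does not contribute; so the coefficient of
    t^nu is the form of degree nu evaluated at the tangent vector. *)
Lemma fsub_lead (K L : comNzRingType) (iota : {rmorphism K -> L}) m (j : 'I_m)
    (h : fps K m) nu (gam : 'I_m -> fps L 1) :
  (forall k, gam k 0%MM = 0) -> gam j = 0 ->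
  (forall a : 'X_{1..m}, a j = 0%N -> (mdeg a < nu)%N -> h a = 0) ->
  exists2 u, fsub iota gam h = tvar ^+ nu * u &
    u 0%MM = mmap iota (fun k => gam k U_(ord0)%MM) (lead_form j nu h).
Proof.
move=> gam0 gamj h0.
have mono0 (a : 'X_{1..m}) : a j != 0%N -> \prod_(k < m) gam k ^+ a k = 0.
  by move=> aj; rewrite (bigD1 j) //= gamj expr0n (negPf aj) mul0r.
exists (tshift nu (fsub iota gam h)).
  apply: tshiftE => d dnu; rewrite /= big1 // => a _.
  have := bmdeg a; rewrite {2}mdeg_expt ltnS => ad.
  have [aj|aj] := eqVneq (a j) 0%N; last by rewrite mono0 // fps0E mulr0.
  by rewrite h0 ?rmorph0 ?mul0r // (leq_ltn_trans ad).
rewrite /lead_form raddf_sum.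
rewrite -[LHS]/(fsub iota gam h (expt (nu + mdeg 0%MM))) mdeg0 addn0.
rewrite [LHS]/= mdeg_expt [RHS]big_mkcond; apply: eq_bigr => a _.
have [g eg g0] := arc_monomial gam0 a.
have [aj|aj] := eqVneq (a j) 0%N; last first.
  by rewrite andbF mono0 // fps0E mulr0.
rewrite andbT; have := bmdeg a; rewrite ltnS leq_eqVlt.
case: eqP => [anu _|_ anu]; last by rewrite h0 // rmorph0 mul0r.
rewrite -[RHS]/(mmap iota _ (h a *: 'X_[a])) mmapZ mmapX eg anu.
by rewrite tXE leqnn subnn expt0 g0.
Qed.

(** The geometric sum of q^(N-1-i) (q - u)^i, with q the constant term of u,
    inverts u up to q^N modulo t^N without any division. *)
Lemma pseudo_inverse (L : comNzRingType) (u : fps L 1) N :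
  exists u' r, u * u' = fps_const 1 (u 0%MM ^+ N) + tvar ^+ N * r.
Proof.
pose c := fps_const 1 (u 0%MM); pose x := c - u.
have xE : x = tvar ^+ 1 * tshift 1 x.
  apply: tshiftE => -[|//] _; rewrite expt0 fpsDE fpsNE /= eqxx mulr1n.
  by rewrite subrr.
exists (\sum_(i < N) c ^+ (N.-1 - i) * x ^+ i), (- tshift 1 x ^+ N).
have {1}-> : u = c - x by rewrite opprB addrC subrK.
by rewrite -subrXX {1}xE exprMn -exprM mul1n rmorphXn mulrN.
Qed.

Lemma nonroot (K : numFieldType) (p : {poly K}) : p != 0 -> exists x, p.[x] != 0.
Proof.
move=> p0; apply: contrapT => h.
have r x : root p x by apply/eqP/eqP; apply: contrapT => /negP px; apply: h; exists x.
pose s := [seq i%:R : K | i <- iota 0 (size p)].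
suff: (size s < size p)%N by rewrite size_map size_iota ltnn.
apply: max_poly_roots => //; first by apply/allP => x _.
by rewrite map_inj_uniq ?iota_uniq // => i k /eqP; rewrite eqr_nat => /eqP.
Qed.

(** Induction on the number of variables: a nonzero coefficient in the last
    variable stays nonzero at some point, and a nonzero polynomial in one variable
    has finitely many roots. *)
Lemma mpoly_nonroot (K : numFieldType) m (p : {mpoly K[m]}) :
  p != 0 -> exists v, p.@[v] != 0.
Proof.
elim: m p => [|m IH] p p0.
  have [a pa] : exists a, p@_a != 0.
    apply: contrapT => h; case/eqP: p0; apply/mpolyP => a; rewrite mcoeff0.
    by apply/eqP; apply: contrapT => /negP pa; apply: h; exists a.
  exists (fun=> 0); rewrite -(mpolyKC p) mevalC.
  by have -> : 0%MM = a by apply/mnmP => -[].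
pose w := @widen_ord m m.+1 (leqnSn m).
have [a pa] : exists a, p@_a != 0.
  apply: contrapT => h; case/eqP: p0; apply/mpolyP => a; rewrite mcoeff0.
  by apply/eqP; apply: contrapT => /negP pa; apply: h; exists a.
pose a' := [multinom a (w i) | i < m].
have [v'] : exists v', ((muni p)`_(a ord_max)).@[v'] != 0.
  apply: IH; apply: contraNneq pa => /(congr1 (mcoeff a')).
  rewrite mcoeff0 muniE coef_sum raddf_sum /= => /eqP; apply: contraTT => pa.
  rewrite (bigD1_seq a) ?mcoeff_msupp ?msupp_uniq //= coefZ coefXn eqxx mulr1.
  rewrite mcoeffZ mcoeffX eqxx mulr1 big1 ?addr0 // => b ba.
  rewrite coefZ coefXn; case: eqP => [eb|_]; last by rewrite mulr0 mcoeff0.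
  rewrite mulr1 mcoeffZ mcoeffX; case: eqP => [/mnmP eb'|_]; rewrite ?mulr0 //.
  case/eqP: ba; apply/mnmP => i; have [->|ilt] := eqVneq i ord_max; first by [].
  have im : (i < m)%N.
    by rewrite ltn_neqAle -ltnS ltn_ord andbT; apply: contraNneq ilt => im; apply/eqP/val_inj.
  have -> : i = w (Ordinal im) by apply: val_inj.
  by have := eb' (Ordinal im); rewrite !mnmE.
pose P := map_poly (meval v') (muni p) => pv.
have [x px] : exists x, P.[x] != 0.
  apply: nonroot; apply: contraNneq pv => P0.
  by rewrite -(coef_map (meval v')) -/P P0 coef0.
exists (fun i => oapp v' x (insub (i : nat))).
apply: contraNneq px => <-; apply/eqP.
rewrite /P muniE rmorph_sum horner_sum mevalE; apply: eq_bigr => c _ /=.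
rewrite map_polyZ map_polyXn hornerZ hornerXn /= mevalZ mevalX -mulrA.
congr (_ * _); rewrite big_ord_recr /= insubF ?ltnn //=; congr (_ * _).
apply: eq_bigr => i _; rewrite mnmE; congr (_ ^+ _).
by rewrite insubT //= => im; congr v'; apply: val_inj.
Qed.

Section CurveIndependence.
Variables (K : numFieldType) (m : nat) (j : 'I_m).
Variables (h : fps K m) (eta : 'I_m -> fps K m).
Hypothesis closed : forall k l, k != j -> l != j -> exists e,
  h * (fps_deriv l (eta k) - fps_deriv k (eta l)) =
  eta k * fps_deriv l h - eta l * fps_deriv k h + fps_var K j * e.

Definition arc_form gam : fps K 1 :=
  \sum_(k < m) fsub idfun gam (eta k) * fps_deriv ord0 (gam k).

(** The coefficient computed with a pseudo-inverse over K[s] specializes to the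
    residue computed with a true inverse, up to the factor [Q]. *)
Lemma eval_quotient nu (a u u' r : fps {poly K} 1) (Q : {poly K}) (s : K)
    (y : fps K 1) :
  u * u' = fps_const 1 Q + tvar ^+ nu.+2 * r ->
  map_fps (horner_eval s) u * y = 1 ->
  Q.[s] * (map_fps (horner_eval s) a * y) (expt nu) =
    ((a * u') (expt nu)).[s].
Proof.
move=> euu uy.
rewrite -[RHS]/(map_fps (horner_eval s) (a * u') (expt nu)).
rewrite (rmorphM _ _ _ : _ = map_fps (horner_eval s) a * map_fps (horner_eval s) u').
have -> : map_fps (horner_eval s) u' =
    y * (fps_const 1 Q.[s] + tvar ^+ nu.+2 * map_fps (horner_eval s) r).
  rewrite -[Q.[s]]/(horner_eval s Q) -map_fps_const -(map_fps_var (horner_eval s)).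
  by rewrite -rmorphXn -rmorphM -rmorphD -euu rmorphM mulrA (mulrC y) uy mul1r.
rewrite mulrA [RHS](congr1 (fun f : fps K 1 => f (expt nu)) (mulrC _ _)).
rewrite mulrDl fpsDE fps_constM -mulrA tX_low ?addr0 //.
by rewrite mdeg_expt.
Qed.

Local Notation C := (@fps_const {poly K} 1).
Local Notation up := (@map_fps _ _ (@polyC K) 1).

(** The arcs are joined by the affine homotopy (1 - s) lam + s gam; the
    residue, a quotient of two polynomials in s, is constant, and it takes the
    two given values at s = 0 and s = 1, where its denominator does not
    vanish. *)
Lemma residue_same (nu : nat) (lam gam : 'I_m -> fps K 1) (y z : fps K 1) ul ug :
  (forall a : 'X_{1..m}, a j = 0%N -> (mdeg a < nu.+1)%N -> h a = 0) ->
  (forall k, lam k 0%MM = 0) -> lam j = 0 ->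
  (forall k, gam k 0%MM = 0) -> gam j = 0 ->
  fsub idfun lam h = tvar ^+ nu.+1 * ul -> ul * y = 1 ->
  fsub idfun gam h = tvar ^+ nu.+1 * ug -> ug * z = 1 ->
  (arc_form gam * z) (expt nu) = (arc_form lam * y) (expt nu).
Proof.
move=> h0 lam0 lamj gam0 gamj el ely eg egz.
pose Gam k := up (lam k) * C (1 - 'X) + up (gam k) * C 'X.
have Gam0 k : Gam k 0%MM = 0.
  by rewrite fpsDE !fpsM0 /= lam0 gam0 !mul0r addr0.
have Gamj : Gam j = 0 by rewrite /Gam lamj gamj !rmorph0 !mul0r addr0.
have evup s f : map_fps (horner_eval s) (up f) = f.
  by apply: fpsP => t; rewrite /= /horner_eval hornerC.
have c0 : fps_const 1 (0 : K) = 0 by rewrite rmorph0.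
have c1 : fps_const 1 (1 : K) = 1 by [].
have evC s c : map_fps (horner_eval s) (C c) = fps_const 1 c.[s].
  exact: map_fps_const.
have X10 : (1 - 'X : {poly K}).[0] = 1 by rewrite !hornerE subr0.
have X11 : (1 - 'X : {poly K}).[1] = 0 by rewrite !hornerE subrr.
have ev0 k : map_fps (horner_eval 0) (Gam k) = lam k.
  by rewrite rmorphD !rmorphM /= !evup !evC X10 hornerX c0 c1 mulr0 mulr1 addr0.
have ev1 k : map_fps (horner_eval 1) (Gam k) = gam k.
  by rewrite rmorphD !rmorphM /= !evup !evC X11 hornerX c0 c1 mulr0 mulr1 add0r.
have evsub s f : map_fps (horner_eval s) (fsub (@polyC K) Gam f) =
    fsub idfun (fun k => map_fps (horner_eval s) (Gam k)) f.
  by apply: map_fsub => c; exact: hornerC.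
pose a := \sum_(k < m) fsub (@polyC K) Gam (eta k) * fps_deriv ord0 (Gam k).
have eva s : map_fps (horner_eval s) a =
    arc_form (fun k => map_fps (horner_eval s) (Gam k)).
  rewrite rmorph_sum; apply: eq_bigr => k _.
  by rewrite rmorphM /= evsub map_fps_deriv.
have [u eb u0] := fsub_lead (@polyC K) Gam0 Gamj h0.
have [u' [r euu]] := pseudo_inverse u nu.+2.
set Q := u 0%MM ^+ nu.+2 in euu.
pose p := (a * u') (expt nu).
have W : p^`() * Q = p * Q^`().
  exact: (log_wronskian (closed_pullback closed Gam0 Gamj) eb euu).
have evu s ws : fsub idfun (fun k => map_fps (horner_eval s) (Gam k)) h =
    tvar ^+ nu.+1 * ws -> map_fps (horner_eval s) u = ws.
  rewrite -evsub eb rmorphM /= rmorphXn /= map_fps_var; exact: tXI.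
have Q_neq0 s x : map_fps (horner_eval s) u * x = 1 -> Q.[s] != 0.
  move=> /(congr1 (fun f : fps K 1 => f 0%MM)); rewrite fpsM0 fps1E eqxx /=.
  rewrite /horner_eval horner_exp => e1; apply/expf_neq0/eqP => u00.
  by move/eqP: e1; rewrite u00 mul0r eq_sym oner_eq0.
have El : fsub idfun (fun k => map_fps (horner_eval 0) (Gam k)) h =
    tvar ^+ nu.+1 * ul by under [X in fsub _ X]funext do rewrite ev0.
have Eg : fsub idfun (fun k => map_fps (horner_eval 1) (Gam k)) h =
    tvar ^+ nu.+1 * ug by under [X in fsub _ X]funext do rewrite ev1.
have Al : map_fps (horner_eval 0) a = arc_form lam.
  by rewrite eva; congr arc_form; apply/funext.
have Ag : map_fps (horner_eval 1) a = arc_form gam.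
  by rewrite eva; congr arc_form; apply/funext.
have ry : map_fps (horner_eval 0) u * y = 1 by rewrite (evu _ _ El).
have rz : map_fps (horner_eval 1) u * z = 1 by rewrite (evu _ _ Eg).
have := eval_quotient a euu ry; rewrite Al -/p => Hl.
have := eval_quotient a euu rz; rewrite Ag -/p => Hg.
have := wronskian0_prop W (Q_neq0 _ _ ry).
(* Q must not unfold when products are evaluated: it is itself a product. *)
move: Q p euu W Q_neq0 Hl Hg => Q p euu W Q_neq0 Hl Hg.
move=> /(congr1 (fun f : {poly K} => f.[1])); rewrite !hornerM !hornerC.
rewrite -Hl -Hg => E; apply: (mulfI (Q_neq0 _ _ rz)).
apply: (mulfI (Q_neq0 _ _ ry)); rewrite [RHS]mulrCA -[RHS]E; ring.
Qed.

(** The generic directions are those where the lowest homogeneous part of h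
    on x_j = 0 does not vanish; the reference arc is a line in such a
    direction. *)
Lemma residue_curve_independent : (exists2 a : 'X_{1..m}, a j = 0%N & h a != 0) ->
  exists (P : {mpoly K[m]}) (c : K),
    (exists2 v : 'I_m -> K, v j = 0 & P.@[v] != 0) /\
    forall gam : 'I_m -> fps K 1, (forall k, gam k 0%MM = 0) -> gam j = 0 ->
      P.@[fun k => gam k U_(ord0)%MM] != 0 ->
      is_residue (arc_form gam) (fsub idfun gam h) c.
Proof.
move=> [a0 a0j ha0].
pose bad d := `[< exists a : 'X_{1..m}, [/\ a j = 0%N, mdeg a = d & h a != 0] >].
have exbad : exists d, bad d by exists (mdeg a0); apply/asboolP; exists a0.
case: (ex_minnP exbad) => nu /asboolP[a1 [a1j a1nu ha1]] numin.
have h0 (a : 'X_{1..m}) : a j = 0%N -> (mdeg a < nu)%N -> h a = 0.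
  move=> aj anu; apply/eqP; apply: contraTT anu => ha; rewrite -leqNgt.
  by apply: numin; apply/asboolP; exists a.
pose P := lead_form j nu h.
have P_neq0 : P != 0.
  apply: contraNneq ha1 => /(congr1 (mcoeff a1)).
  have a1lt : (mdeg a1 < nu.+1)%N by rewrite a1nu.
  rewrite mcoeff0 /P /lead_form raddf_sum (bigD1 (BMultinom a1lt)) /=; last first.
    by rewrite a1nu a1j !eqxx.
  rewrite mcoeffZ mcoeffX eqxx mulr1 big1 ?addr0 => [->//|b /andP[_]].
  rewrite bmeqP /= => /negPf ba.
  by rewrite mcoeffZ mcoeffX ba mulr0.
have Pj v w : (forall k, k != j -> v k = w k) -> P.@[v] = P.@[w].
  move=> vw; rewrite /P /lead_form !raddf_sum; apply: eq_bigr => a /andP[_ /eqP aj].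
  rewrite /= !mevalZ !mevalX; congr (_ * _); apply: eq_bigr => k _.
  by have [->|kj] := eqVneq k j; rewrite ?aj ?expr0 ?vw.
have [v0' Pv0'] := mpoly_nonroot P_neq0.
(* The form P does not involve x_j, so the direction can be taken in x_j = 0. *)
pose v0 k := if k == j then 0 else v0' k.
have Pv0 : P.@[v0] != 0.
  by rewrite (Pj _ v0') // => k /negPf kj; rewrite /v0 kj.
have v0j : v0 j = 0 by rewrite /v0 eqxx.
have unit_of (gam : 'I_m -> fps K 1) : (forall k, gam k 0%MM = 0) -> gam j = 0 ->
    P.@[fun k => gam k U_(ord0)%MM] != 0 ->
    exists u y, fsub idfun gam h = tvar ^+ nu * u /\ u * y = 1.
  move=> gam0 gamj Pg; have [u eu u0] := fsub_lead idfun gam0 gamj h0.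
  have [|y uy] := @fps_inv _ u; first by rewrite u0.
  by exists u, y.
exists P.
pose lam k : fps K 1 := fps_const 1 (v0 k) * tvar.
have lam0 k : lam k 0%MM = 0 by rewrite -expt0 /lam mulrC tM0.
have lamj : lam j = 0 by rewrite /lam v0j rmorph0 mul0r.
have Plam : P.@[fun k => lam k U_(ord0)%MM] != 0.
  have -> : (fun k => lam k U_(ord0)%MM) = v0 => //.
  by apply/funext => k; rewrite /lam fps_constM /= eqxx mulr1.
have [ul [y [el ely]]] := unit_of _ lam0 lamj Plam.
exists (if nu is nu'.+1 then (arc_form lam * y) (expt nu') else 0).
split; first by exists v0.
move=> gam gam0 gamj Pg; have [ug [z [eg egz]]] := unit_of _ gam0 gamj Pg.
exists nu, ug, z; split => //.
case: (nu) h0 el eg => // nu' h0 el eg.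
exact: esym (residue_same h0 lam0 lamj gam0 gamj el ely eg egz).
Qed.

End CurveIndependence.

Lemma fps_mul_sum (L : comNzRingType) n (f g : fps L n) d m : (mdeg m < d)%N ->
  (f * g) m = \sum_(k : 'X_{1..n < d, d} | m == (k.1 + k.2)%MM) f k.1 * g k.2.
Proof.
move=> md; rewrite (fpsME f g md) (mcoeff_poly_mul _ _ md).
by apply: eq_bigr => k _; rewrite !fps_truncE ?bmdeg.
Qed.

(** In a degree-compatible monomial order the coefficient of the product at the
    product of the two lowest monomials has a single nonzero term. *)
Lemma fps_mul_eq0 (L : idomainType) n (f g : fps L n) : f * g = 0 -> f = 0 \/ g = 0.
Proof.
move=> fg0; apply: contrapT => /not_orP[f0 g0].
have nz (p : fps L n) : p <> 0 -> exists a, p a != 0.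
  move=> p0; apply: contrapT => h; apply: p0; apply: fpsP => a; rewrite fps0E.
  by apply/eqP; apply: contrapT => /negP pa; apply: h; exists a.
have [a fa] := nz f f0; have [b gb] := nz g g0.
pose d := (mdeg a + mdeg b).+1.
have tnz (p : fps L n) c : p c != 0 -> (mdeg c < d)%N ->
    exists2 m, (fps_trunc d p)@_m != 0 /\ (mdeg m <= mdeg c)%N &
    forall k, (fps_trunc d p)@_k != 0 -> (m <= k)%O.
  move=> pc cd; exists (mlast (fps_trunc d p)); last first.
    by move=> k pk; apply: mlast_lemc; rewrite mcoeff_msupp.
  have pc' : (fps_trunc d p)@_c != 0 by rewrite fps_truncE.
  split; last by apply: lemc_mdeg; apply: mlast_lemc; rewrite mcoeff_msupp.
  rewrite -mcoeff_msupp mlast_supp //; apply: contraNneq pc' => ->.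
  by rewrite mcoeff0.
have [|m1 [fm1 m1a] m1min] := tnz f a fa; first by rewrite ltnS leq_addr.
have [|m2 [gm2 m2b] m2min] := tnz g b gb; first by rewrite ltnS leq_addl.
have md : (mdeg (m1 + m2)%MM < d)%N by rewrite mdegD ltnS leq_add.
have := fps0E L (m1 + m2)%MM; rewrite -fg0 (fpsME f g md) (mcoeff_poly_mul _ _ md).
have m1d : (mdeg m1 < d)%N by apply: leq_ltn_trans md; rewrite mdegD leq_addr.
have m2d : (mdeg m2 < d)%N by apply: leq_ltn_trans md; rewrite mdegD leq_addl.
rewrite (bigD1 (BMultinom m1d, BMultinom m2d)) //= big1 ?addr0 => [/eqP|].
  by rewrite mulf_eq0 (negPf fm1) (negPf gm2).
move=> [k1 k2] /= /andP[/eqP e ne].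
apply/eqP; rewrite mulf_eq0 -[_ || _]negbK negb_or; apply/negP => /andP[h1 h2].
have l1 := m1min _ h1; have l2 := m2min _ h2.
have e1 : m1 = k1.
  apply/eqP; rewrite eq_le l1 /= leNgt; apply/negP => lt1.
  by have := ltmc_le_add lt1 l2; rewrite -e ltxx.
case/negP: ne; rewrite xpair_eqE !bmeqP /= -e1 eqxx /=.
by move/eqP: e; rewrite -e1 eqm_add2l eq_sym.
Qed.

(** * Convergent germs *)

Lemma mdeg_lift n (i : 'I_n) (a : 'X_{1..n}) :
  (mdeg [multinom a (lift i k) | k < n.-1] <= mdeg a)%N.
Proof.
case: n i a => [|n] i a; first by case: i.
rewrite !mdegE (bigD1_ord i) //=; under eq_bigr do rewrite mnmE.
exact: leq_addl.
Qed.

Section Germs.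
Variables (K : numFieldType).

Lemma holo_eqP m (f g : holo K m) : (f : fps K m) = g -> f = g.
Proof. exact: val_inj. Qed.

Lemma holo_mul_eq0 m (f g : holo K m) : f * g = 0 -> f = 0 \/ g = 0.
Proof.
move=> fg; have [|f0|g0] := @fps_mul_eq0 _ _ (f : fps K m) (g : fps K m).
- by rewrite -[RHS]/(holo_val (0 : holo K m)) -fg.
- by left; apply: holo_eqP.
- by right; apply: holo_eqP.
Qed.

Lemma holo_mulfI m (f : holo K m) : f != 0 -> injective ( *%R f).
Proof.
move=> f0 g h e; apply/eqP; rewrite -subr_eq0; apply/eqP.
have [|f00|//] := @holo_mul_eq0 _ f (g - h); last by rewrite f00 eqxx in f0.
by rewrite mulrBr (e : f * g = _) subrr.
Qed.

(** Halving the radius absorbs the factor deg + 1 that a derivative costs. *)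
Lemma convergent_shift m (i : 'I_m) (f g : fps K m) :
  f \in @convergent K m ->
  (forall a, `|g a| <= `|f (a + U_(i))%MM| *+ (mdeg a).+1) ->
  g \in @convergent K m.
Proof.
move=> /asboolP[r r0 [M hM]] gf; apply/asboolP; exists (r / 2%:R).
  by rewrite divr_gt0 // ltr0n.
exists (M / r) => d; rewrite ler_pdivlMr // mulr_suml.
apply: le_trans (hM d.+1).
have hd (a : 'X_{1..m < d}) : (mdeg (a + U_(i))%MM < d.+1)%N.
  by rewrite mdegD mdeg1 addn1 ltnS bmdeg.
apply: le_trans (sum_inj_le (P := xpredT) (h := fun a => BMultinom (hd a))
  (F := fun a : 'X_{1..m < d.+1} => `|f a| * r ^+ mdeg a) _ _).
- apply: ler_sum => a _ /=; rewrite mdegD mdeg1 addn1 exprSr mulrA.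
  apply: ler_wpM2r; first exact: ltW.
  rewrite expr_div_n mulrCA mulrA [leRHS]mulrC -mulrA; apply: ler_wpM2l.
    by rewrite exprn_ge0 // ltW.
  rewrite ler_pdivrMr ?exprn_gt0 ?ltr0n // (le_trans (gf a)) //.
  by rewrite -[leLHS]mulr_natr ler_wpM2l // -natrX ler_nat ltn_expl.
- by move=> a b _ _ /(congr1 (@bmnm _ _)) /= /addIm /val_inj.
- by move=> a; rewrite mulr_ge0 // exprn_ge0 // ltW.
Qed.

Variable m : nat.
Implicit Types (f g : holo K m).

Lemma pderiv_subproof (i : 'I_m) f : fps_deriv i f \in @convergent K m.
Proof.
apply: (@convergent_shift _ i f); first by case: f.
move=> a; rewrite /= normrMn ler_wpMn2l // ltnS.
by rewrite mdegE (bigD1 i) //= leq_addr.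
Qed.
Definition pderiv i f : holo K m := Holo (pderiv_subproof i f).

(** The quotient by x_i of a series divisible by x_i. *)
Definition fps_div_var (i : 'I_m) (f : fps K m) : fps K m :=
  FPS (fun a => f (a + U_(i))%MM).

Lemma div_var_subproof (i : 'I_m) f : fps_div_var i f \in @convergent K m.
Proof.
apply: (@convergent_shift _ i f) => [|a]; first by case: f.
by rewrite mulrS lerDl mulrn_wge0.
Qed.

Lemma pderivD i : {morph pderiv i : f g / f + g}.
Proof. by move=> f g; apply: holo_eqP; exact: fps_derivD. Qed.

Lemma pderivM i f g : pderiv i (f * g) = f * pderiv i g + g * pderiv i f.
Proof. by apply: holo_eqP; exact: fps_derivM. Qed.

Lemma pderivC i c : pderiv i (const m c) = 0.
Proof. by apply: holo_eqP; exact: fps_derivC. Qed.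

Lemma pderiv_var i k : pderiv i (var K k) = (k == i)%:R.
Proof.
apply: holo_eqP; rewrite [LHS]fps_deriv_var.
by case: (k == i).
Qed.

Lemma restr_eq0P (i : 'I_m) f : restr i f = 0 <-> exists g, f = var K i * g.
Proof.
split=> [f0|[g ->]]; last first.
  apply: holo_eqP; apply: fpsP => a; rewrite fps0E.
  rewrite -[LHS]/((fps_var K i * (g : fps K m)) (mnm_restr i a)) fps_varM.
  by rewrite mnmE unlift_none.
exists (Holo (div_var_subproof i f)); apply: holo_eqP; apply: fpsP => a.
rewrite -[RHS]/((fps_var K i * fps_div_var i f) a) fps_varM.
case: ifP => ai /=.
  by rewrite submK //; apply/mnm_lepP => k; rewrite mnm1E; case: eqP => // <-.
pose a' : 'X_{1..m.-1} := [multinom a (lift i k) | k < m.-1].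
have -> : a = mnm_restr i a'.
  apply/mnmP => k; rewrite mnmE; case: unliftP => [k' ->|->] /=.
    by rewrite mnmE.
  by apply/eqP; rewrite -leqn0 leqNgt ai.
rewrite -[LHS]/((restr i f : fps K m.-1) a') f0; exact: fps0E.
Qed.

End Germs.

Section Restriction.
Variables (K : numFieldType) (m : nat) (i : 'I_m).
Implicit Types (f g : holo K m).

Definition mnm_drop (a : 'X_{1..m}) : 'X_{1..m.-1} :=
  [multinom a (lift i k) | k < m.-1].

Lemma mnm_restrK : cancel (mnm_restr i) mnm_drop.
Proof. by move=> a; apply/mnmP => k; rewrite !mnmE liftK. Qed.

Lemma mnm_dropK (a : 'X_{1..m}) : a i = 0%N -> mnm_restr i (mnm_drop a) = a.
Proof.
move=> ai; apply/mnmP => k; rewrite mnmE.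
by case: unliftP => [k' ->|->] /=; rewrite ?mnmE.
Qed.

Lemma mnm_restrD a b :
  mnm_restr i (a + b)%MM = (mnm_restr i a + mnm_restr i b)%MM.
Proof.
apply/mnmP => k; rewrite mnmDE !mnmE.
by case: unliftP => [k' _|_] //=; rewrite mnmDE.
Qed.

Lemma mdeg_drop_le a d : (mdeg a < d)%N -> (mdeg (mnm_drop a) < d)%N.
Proof.
exact/leq_ltn_trans/mdeg_lift.
Qed.

Lemma restrM f g : restr i (f * g) = restr i f * restr i g.
Proof.
apply: holo_eqP; apply: fpsP => a; pose d := (mdeg a).+1.
rewrite -[LHS]/(((f : fps K m) * (g : fps K m)) (mnm_restr i a)).
rewrite -[RHS]/((fps_restr i f * fps_restr i g) a).
rewrite (@fps_mul_sum _ _ _ _ d) ?mdeg_restr // (@fps_mul_sum _ _ _ _ d) //.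
have hr (b : 'X_{1..m.-1 < d}) : (mdeg (mnm_restr i b) < d)%N.
  by rewrite mdeg_restr bmdeg.
pose up (b : 'X_{1..m.-1 < d, d}) :=
  (BMultinom (hr b.1), BMultinom (hr b.2)) : 'X_{1..m < d, d}.
pose down (b : 'X_{1..m < d, d}) : 'X_{1..m.-1 < d, d} :=
  (BMultinom (mdeg_drop_le (bmdeg b.1)), BMultinom (mdeg_drop_le (bmdeg b.2))).
rewrite (reindex_onto up down) => [|[b1 b2] /= /eqP eb]; last first.
  have := congr1 (fun c : 'X_{1..m} => c i) eb.
  rewrite mnmDE mnmE unlift_none => /esym/eqP; rewrite addn_eq0.
  move=> /andP[/eqP b10 /eqP b20].
  by congr pair; apply: val_inj; rewrite /= mnm_dropK.
apply: eq_big => [[b1 b2]|b _] //=.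
rewrite -mnm_restrD (inj_eq (@mnm_restr_inj _ i)) xpair_eqE.
by rewrite !bmeqP /= !mnm_restrK !eqxx ?andbT.
Qed.

Lemma restr1 : restr i (1 : holo K m) = 1.
Proof.
apply: holo_eqP; apply: fpsP => a; rewrite /= -!mdeg_eq0.
by rewrite mdeg_restr.
Qed.

Lemma restr_zmod : zmod_morphism (@restr K m i).
Proof. by move=> f g; apply: holo_eqP; apply: fpsP. Qed.

HB.instance Definition _ :=
  GRing.isZmodMorphism.Build (holo K m) (holo K m.-1) (@restr K m i) restr_zmod.
HB.instance Definition _ :=
  GRing.isMonoidMorphism.Build (holo K m) (holo K m.-1) (@restr K m i)
    (restr1, restrM).

Lemma restr_var k : restr i (var K k) = oapp (@var K m.-1) 0 (unlift i k).
Proof.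
case: unliftP => [k' ->|->] /=.
  apply: holo_eqP; apply: fpsP => a /=; congr ((nat_of_bool _)%:R).
  apply/eqP/eqP => [e|->].
    by rewrite -(mnm_restrK a) e; apply/mnmP => l; rewrite !mnmE (inj_eq lift_inj).
  apply/mnmP => l; rewrite !mnmE.
  case: unliftP => [l' ->|->] /=; rewrite ?mnmE ?(inj_eq lift_inj) //.
  by rewrite eq_sym (negPf (neq_lift _ _)).
by apply/restr_eq0P; exists 1; rewrite mulr1.
Qed.

Lemma restr_pderiv (k : 'I_m.-1) f :
  restr i (pderiv (lift i k) f) = pderiv k (restr i f).
Proof.
apply: holo_eqP; apply: fpsP => a /=; rewrite mnm_restrD mnmE liftK /=.
congr (holo_val f _ *+ _); congr (_ + _)%MM; apply/mnmP => l.
rewrite !mnmE; case: unliftP => [l' ->|->] /=; rewrite ?mnmE ?(inj_eq lift_inj) //.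
by rewrite eq_sym (negPf (neq_lift _ _)).
Qed.

Lemma lift_subproof (g : holo K m.-1) :
  FPS (fun a => if a i == 0%N then (g : fps K m.-1) (mnm_drop a) else 0)
    \in @convergent K m.
Proof.
case: g => g /= /asboolP[r r0 [M hM]]; apply/asboolP; exists r => //.
exists M => d; apply: le_trans (hM d).
rewrite (bigID (fun a : 'X_{1..m < d} => bmnm a i == 0%N)) /= [X in _ + X]big1.
  rewrite addr0.
  apply: le_trans (sum_inj_le
    (P := fun a : 'X_{1..m < d} => bmnm a i == 0%N)
    (h := fun a => BMultinom (mdeg_drop_le (bmdeg a)))
    (F := fun a : 'X_{1..m.-1 < d} => `|g a| * r ^+ mdeg a) _ _).
  - apply: ler_sum => a /[dup] ai -> /=.
    by rewrite -{2}(mnm_dropK (eqP ai)) mdeg_restr.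
  - move=> a b /eqP ai /eqP bi /(congr1 (@bmnm _ _)) /= ab; apply: val_inj.
    by rewrite /= -(mnm_dropK ai) ab mnm_dropK.
  - by move=> a; rewrite mulr_ge0 // exprn_ge0 // ltW.
by move=> a /negPf ->; rewrite normr0 mul0r.
Qed.

(** A function on the hyperplane extends as a function constant in x_i. *)
Lemma restr_surj (g : holo K m.-1) : exists f, restr i f = g.
Proof.
exists (Holo (lift_subproof g)); apply: holo_eqP; apply: fpsP => a /=.
by rewrite mnmE unlift_none eqxx mnm_restrK.
Qed.

End Restriction.

(** * Coordinates and vector fields *)

Section Coordinates.
Variables (K : numFieldType) (m : nat).
Implicit Types (f g : holo K m) (i k : 'I_m).

Definition divides (x f : holo K m) : Prop := exists g, f = x * g.

Lemma divides_restr i f : divides (var K i) f <-> restr i f = 0.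
Proof. by rewrite restr_eq0P. Qed.

Lemma dividesMl x f g : divides x f -> divides x (g * f).
Proof. by move=> [h ->]; exists (g * h); rewrite mulrCA. Qed.

Lemma dividesMr x f g : divides x f -> divides x (f * g).
Proof. by move=> [h ->]; exists (h * g); rewrite mulrA. Qed.

Lemma dividesB x f g : divides x f -> divides x g -> divides x (f - g).
Proof. by move=> [h ->] [k ->]; exists (h - k); rewrite mulrBr. Qed.

(** The quotient by x_i is the ring of germs on the hyperplane, a domain. *)
Lemma coord_prime i f g :
  divides (var K i) (f * g) -> divides (var K i) f \/ divides (var K i) g.
Proof.
rewrite !divides_restr rmorphM => fg0.
exact: holo_mul_eq0 fg0.
Qed.

Lemma var_neq0 k : var K k != 0.
Proof.
apply/eqP => v0; have := congr1 (fun f : holo K m => f U_(k)%MM) v0.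
by rewrite /= eqxx mul0rn => /eqP; rewrite oner_eq0.
Qed.

End Coordinates.

Lemma coord_ndvd (K : numFieldType) m (i k : 'I_m) :
  i != k -> ~ divides (var K i) (var K k).
Proof.
rewrite divides_restr restr_var; case: unliftP => [k' _|->] /= ik.
  by apply/eqP; rewrite var_neq0.
by rewrite eqxx in ik.
Qed.

Section VectorFields.
Variables (K : numFieldType) (m : nat).
Implicit Types (f g : holo K m) (i k : 'I_m) (S : pred 'I_m).

Lemma coord_ndvd_prod i S : ~~ S i ->
  ~ divides (var K i) (\prod_(k | S k) var K k).
Proof.
move=> Si; elim/big_rec: _ => [|k x Sk IH].
  by rewrite divides_restr rmorph1 => /eqP; rewrite oner_eq0.
case/coord_prime => //; apply: coord_ndvd.
by apply: contraNneq Si => ->.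
Qed.

Lemma prod_coord_divides S f : (forall k, S k -> divides (var K k) f) ->
  divides (\prod_(k | S k) var K k) f.
Proof.
move=> Sf; rewrite -big_filter.
have : forall k, k \in [seq k <- index_enum 'I_m | S k] -> divides (var K k) f.
  by move=> k; rewrite mem_filter => /andP[/Sf].
have : uniq [seq k <- index_enum 'I_m | S k].
  by rewrite filter_uniq // index_enum_uniq.
elim: [seq k <- _ | _] => [|k s IH] /=; first by exists f; rewrite big_nil mul1r.
move=> /andP[ks us] sf; rewrite big_cons.
have [|g eg] := IH us; first by move=> l ls; apply: sf; rewrite inE ls orbT.
have := sf k (mem_head _ _); rewrite eg => /coord_prime[|[h ->]]; last first.
  by exists h; rewrite mulrCA mulrA.
move=> ds; exfalso; elim: s ks {us IH sf eg} ds => [|l s IH].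
  rewrite big_nil divides_restr rmorph1 => _ /eqP.
  by rewrite oner_eq0.
rewrite inE negb_or big_cons => /andP[kl ks] /coord_prime[|]; last exact: IH.
exact: coord_ndvd.
Qed.

Definition vfun (a : 'I_m -> holo K m) f := \sum_k a k * pderiv k f.

Lemma vfunD a f g : vfun a (f + g) = vfun a f + vfun a g.
Proof. by rewrite -big_split; apply: eq_bigr => k _; rewrite pderivD mulrDr. Qed.

Lemma vfunB a f g : vfun a (f - g) = vfun a f - vfun a g.
Proof. by apply/eqP; rewrite eq_sym subr_eq -vfunD subrK. Qed.

Lemma vfunM a f g : vfun a (f * g) = f * vfun a g + g * vfun a f.
Proof.
rewrite !mulr_sumr -big_split; apply: eq_bigr => k _.
by rewrite pderivM mulrDr !(mulrCA (a k)).
Qed.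

Lemma vfun_const a c : vfun a (const m c) = 0.
Proof. by rewrite /vfun big1 // => k _; rewrite pderivC mulr0. Qed.

Lemma vfunC a c f : vfun a (const m c * f) = const m c * vfun a f.
Proof. by rewrite vfunM vfun_const mulr0 addr0. Qed.

Lemma vfun_var a k : vfun a (var K k) = a k.
Proof.
rewrite /vfun (bigD1 k) //= pderiv_var eqxx mulr1 big1 ?addr0 // => l lk.
by rewrite pderiv_var eq_sym (negPf lk) mulr0.
Qed.

Definition vfield a : der (@const K m) := Der (vfunD a) (vfunM a) (vfunC a).

Lemma log_vfun_prod a S : (forall k, S k -> divides (var K k) (a k)) ->
  divides (\prod_(k | S k) var K k) (vfun a (\prod_(k | S k) var K k)).
Proof.
move=> Sa; elim/big_rec: _ => [|k x Sk [b eb]].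
  by exists (vfun a 1); rewrite mul1r.
have [c ec] := Sa k Sk; rewrite vfunM vfun_var ec eb.
by exists (b + c); ring.
Qed.

End VectorFields.

(** * Derivations of a normal crossings germ *)

Section NormalCrossingsFields.
Variables (K : numFieldType) (n r : nat).
Local Notation A := (nc K n r).
Local Notation clsn := (@cls (holo K n) (nc_eqn K n r)).

Lemma cls_eq0 f : clsn f = 0 <-> divides (nc_eqn K n r) f.
Proof.
rewrite -(rmorph0 clsn); split.
  by move/cls_eqP; rewrite subr0 => /asboolP[b ->]; exists b; rewrite mulrC.
by move=> [b ->]; apply/cls_eqP; rewrite subr0; apply/asboolP; exists b; rewrite mulrC.
Qed.

Lemma cls_eq f g : clsn f = clsn g <-> divides (nc_eqn K n r) (f - g).
Proof.
rewrite -cls_eq0 rmorphB /=; split => /eqP; first by rewrite -subr_eq0 => /eqP.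
by rewrite subr_eq0 => /eqP.
Qed.

Variable a : 'I_n -> holo K n.
Hypothesis log_a : forall k : 'I_n, (k < r)%N -> divides (var K k) (a k).

Lemma vfun_nc f : divides (nc_eqn K n r) f -> divides (nc_eqn K n r) (vfun a f).
Proof.
move=> [g ->]; rewrite vfunM; have [b ->] := log_vfun_prod log_a.
by exists (vfun a g + g * b); rewrite mulrDr mulrCA.
Qed.

(** The vector field [a] preserves the ideal of X because it is tangent to every
    component, so it can be evaluated on representatives. *)
Definition nc_vfun (x : A) : A := clsn (vfun a (repr (x : Quotient.quot _))).

Lemma nc_vfunE f : nc_vfun (clsn f) = clsn (vfun a f).
Proof.
apply/cls_eq; rewrite -vfunB; apply/vfun_nc/cls_eq.
exact: (reprK (clsn f : Quotient.quot (princ (nc_eqn K n r)))).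
Qed.

Lemma nc_vfunD x y : nc_vfun (x + y) = nc_vfun x + nc_vfun y.
Proof.
have [f ->] := cls_surj x; have [g ->] := cls_surj y.
by rewrite -rmorphD !nc_vfunE vfunD rmorphD.
Qed.

Lemma nc_vfunM x y : nc_vfun (x * y) = x * nc_vfun y + y * nc_vfun x.
Proof.
have [f ->] := cls_surj x; have [g ->] := cls_surj y.
by rewrite -rmorphM !nc_vfunE vfunM rmorphD !rmorphM.
Qed.

Lemma nc_vfunC c x : nc_vfun (nc_const n r c * x) = nc_const n r c * nc_vfun x.
Proof.
have [f ->] := cls_surj x.
by rewrite /nc_const -rmorphM !nc_vfunE vfunC rmorphM.
Qed.

Definition nc_vfield : der (@nc_const K n r) := Der nc_vfunD nc_vfunM nc_vfunC.

End NormalCrossingsFields.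

Section Membership.
Variables (K : numFieldType) (n r : nat) (T : der (@nc_const K n r) -> Prop).
Hypothesis T_torsionless : torsionless_quotient T.
Variable a : 'I_n -> holo K n.
Hypothesis log_a : forall k : 'I_n, (k < r)%N -> divides (var K k) (a k).
Local Notation clsn := (@cls (holo K n) (nc_eqn K n r)).

Definition other_coords (i : 'I_n) : holo K n :=
  \prod_(k < n | (k < r)%N && (k != i)) var K k.

Lemma nc_eqnE (i : 'I_n) : (i < r)%N -> nc_eqn K n r = var K i * other_coords i.
Proof. by move=> ir; rewrite /nc_eqn (bigD1 i). Qed.

(** On X_i the field [a] becomes, after multiplication by a nonzero function [S],
    a multiple of an element of T. The factors live on the ambient space, so
    that they can multiply derivations of the local ring of X. *)
Definition restricts_into (i : 'I_n) : Prop := exists S B : holo K n,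
  restr i S != 0 /\ exists2 v, T v &
  forall f g, v (clsn f) = clsn g -> restr i (S * vfun a f) = restr i (B * g).

(** A linear form that kills T sends the field to some F. If pi_i is the product
    of the other coordinates, then pi_i S times the field equals pi_i B times an
    element of T, both sides being zero on the other components; so pi_i S F = 0
    and F vanishes on X_i, for all i. Hence F = 0, and the quotient by T being
    torsion-less, the field is in T. *)
Lemma mem_of_restrictions :
  (forall i : 'I_n, (i < r)%N -> restricts_into i) -> T (nc_vfield log_a).
Proof.
move=> Ta; apply: T_torsionless => phi phiT.
have [F eF] := cls_surj (phi (nc_vfield log_a)); rewrite eF.
apply/cls_eq0/prod_coord_divides => i ir.
have [S [B [S0 [v Tv vSB]]]] := Ta i ir.
have E : clsn (other_coords i * S) *: nc_vfield log_a =
    clsn (other_coords i * B) *: v.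
  apply: derP => x; have [f ->] := cls_surj x.
  rewrite /= (nc_vfunE log_a); have [g eg] := cls_surj (v (clsn f)).
  rewrite eg -!rmorphM; apply/cls_eq.
  have /divides_restr[c ec] : restr i (S * vfun a f - B * g) = 0.
    by rewrite rmorphB /= (vSB _ _ eg) subrr.
  exists c; rewrite (nc_eqnE ir).
  transitivity (other_coords i * (S * vfun a f - B * g)); first by ring.
  by rewrite ec; ring.
have := congr1 phi E; rewrite !linearZ /= (phiT v Tv) eF => e.
have {}e : clsn (other_coords i * S * F) = 0.
  by rewrite rmorphM; etransitivity; first exact: e; exact: mulr0.
have /cls_eq0[c ec] := e.
have : divides (var K i) (other_coords i * (S * F)).
  by exists (other_coords i * c); rewrite mulrA ec (nc_eqnE ir) mulrA.
case/coord_prime => [|/coord_prime[|//]]; last first.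
  by move/divides_restr => S00; rewrite S00 eqxx in S0.
by move/coord_ndvd_prod; case; rewrite eqxx andbF.
Qed.

Lemma restricts_into0 (i : 'I_n) :
  (forall f, divides (var K i) (vfun a f)) -> restricts_into i.
Proof.
move=> ai; exists 1, 0; split; first by rewrite rmorph1 oner_eq0.
exists 0 => [|f g _]; first by apply: T_torsionless => phi _; rewrite linear0.
by rewrite mul1r mul0r rmorph0; apply/divides_restr.
Qed.

Lemma restricts_into_fol (i : 'I_n) (w : der (@const K n.-1)) b :
  fol_restr T i w -> (forall f, restr i (vfun a f) = b * w (restr i f)) ->
  restricts_into i.
Proof.
move=> [s [s0 [v Tv vw]]] aw.
have [S eS] := restr_surj i s; have [B eB] := restr_surj i b.
exists S, B; rewrite eS; split=> //; exists v => // f g /vw /= e.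
by rewrite !rmorphM /= eS eB aw -e mulrCA.
Qed.

End Membership.

Section LogRelation.
Variables (K : numFieldType) (n r : nat) (r_le_n : (r <= n)%N).
Variable T : der (@nc_const K n r) -> Prop.
Local Notation clsn := (@cls (holo K n) (nc_eqn K n r)).
Local Notation wid := (widen_ord r_le_n).

(** The ideal of the stratum x_i = x_j = 0. *)
Definition in_stratum (i j : 'I_n) (F : holo K n) : Prop :=
  exists p q, F = var K i * p + var K j * q.

Lemma in_stratumD i j F G :
  in_stratum i j F -> in_stratum i j G -> in_stratum i j (F + G).
Proof. by move=> [p [q ->]] [p' [q' ->]]; exists (p + p'), (q + q'); ring. Qed.

(** The product of all coordinates but one still contains x_i or x_j. *)
Lemma in_stratum_other (i j k : 'I_n) F : (i < r)%N -> (j < r)%N -> i != j ->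
  in_stratum i j (other_coords K r k * F).
Proof.
move=> ir jr ij; have [ik|ki] := eqVneq k i.
  rewrite /other_coords (bigD1 j) /= ?jr ?ik 1?eq_sym //.
  by rewrite -mulrA; set p := _ * F; exists 0, p; ring.
rewrite /other_coords (bigD1 i) /= ?ir 1?eq_sym //.
by rewrite -mulrA; set p := _ * F; exists p, 0; ring.
Qed.

Lemma in_stratum_nc (i j : 'I_n) F : (i < r)%N -> (j < r)%N -> i != j ->
  divides (nc_eqn K n r) F -> in_stratum i j F.
Proof.
move=> ir jr ij [G ->]; rewrite (nc_eqnE _ ir) mulrAC mulrC.
exact: in_stratum_other.
Qed.

(** The classes of [U m] and [U' m] are the unit u_m with x_m = alpha(e_m) u_m
    and its inverse: the relation expresses that the logarithmic derivatives of the alpha(e_m) along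
    T sum to zero. *)
Lemma semistable_relation : semistable T ->
  exists U U' : 'I_r -> holo K n,
  forall (a G : 'I_n -> holo K n)
    (log_a : forall k : 'I_n, (k < r)%N -> divides (var K k) (a k)),
    (forall k : 'I_n, (k < r)%N -> a k = var K k * G k) ->
    T (nc_vfield log_a) ->
  forall i j : 'I_n, (i < r)%N -> (j < r)%N -> i != j ->
    in_stratum i j (\sum_(m < r) G (wid m) - \sum_(m < r) U' m * vfun a (U m)).
Proof.
move=> [M [f [[beta [chart_beta beta1 betaU]] T_log]]].
have [b0 bD _ _] := chart_beta.
have /boolp.choice[U /boolp.choice[U' UU']] :
    forall m : 'I_r, exists U U' : holo K n, clsn U' * clsn U = 1 /\
      log_alpha (beta U_(m)%MM) * clsn U = nc_var K r (wid m).
  move=> m; have [u [b bu] xu] := betaU m (wid m) erefl.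
  have [Uu eU] := cls_surj u; have [Ub eb] := cls_surj b.
  by exists Uu, Ub; rewrite -eU -eb.
exists U, U' => a G log_a aG /T_log[delta [deltaD deltaA delta_flat]] i j ir jr ij.
have delta0 : delta 0 = 0.
  by apply: (addrI (delta 0)); rewrite -deltaD !addr0.
have sum_delta : \sum_(m < r) delta (beta U_(m)%MM) = 0.
  rewrite -[RHS](delta_flat 1%N 1 (oner_neq0 _)) -beta1.
  have -> : [multinom 1%N | _ < r] = (\big[mnm_add/0%MM]_(m < r) U_(m))%MM.
    by apply/mnmP => l; rewrite mnm_sumE (bigD1 l) //= !mnmE eqxx big1 // => k kl;
      rewrite mnm1E (negPf kl).
  by rewrite (big_morph beta bD b0) (big_morph delta deltaD delta0).
have /boolp.choice[D DP] : forall m, exists D, delta (beta U_(m)%MM) = clsn D.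
  by move=> m; exact: cls_surj.
have sumD : divides (nc_eqn K n r) (\sum_(m < r) D m).
  by apply/cls_eq0; rewrite rmorph_sum -[RHS]sum_delta; apply: eq_bigr => m _.
(* The logarithmic derivative of x_m is determined up to the annihilator of x_m,
   which is generated by the product of the other coordinates. *)
have term m : exists e, G (wid m) - U' m * vfun a (U m) - D m =
    other_coords K r (wid m) * e.
  have [uu xu] := UU' m; have := deltaA (beta U_(m)%MM); rewrite DP.
  set al := log_alpha _ in xu *; move=> eal.
  have wr : (wid m < r)%N by rewrite /= ltn_ord.
  have ea : nc_vfield log_a (clsn (var K (wid m))) =
      clsn (var K (wid m)) * clsn (G (wid m)).
    by rewrite /= (nc_vfunE log_a) vfun_var aG // rmorphM.
  have eu : nc_vfield log_a (clsn (U m)) = clsn (vfun a (U m)).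
    by rewrite /= (nc_vfunE log_a).
  have : divides (nc_eqn K n r)
      (var K (wid m) * (G (wid m) - U' m * vfun a (U m) - D m)).
    apply/cls_eq0; rewrite rmorphM !rmorphB rmorphM /= -eu mulrBr mulrBr -ea.
    rewrite -[clsn (var K (wid m))]/(nc_var K r (wid m)) -xu derM -eal.
    set x := clsn (U m) in uu *; set y := nc_vfield _ _; set z := clsn (D m).
    transitivity (al * y * (1 - clsn (U' m) * x)); first by ring.
    by rewrite uu subrr mulr0.
  move=> [e]; rewrite (nc_eqnE _ wr) -mulrA => /(holo_mulfI (var_neq0 _ _)).
  by exists e.
have -> : \sum_(m < r) G (wid m) - \sum_(m < r) U' m * vfun a (U m) =
    \sum_(m < r) (G (wid m) - U' m * vfun a (U m) - D m) + \sum_(m < r) D m.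
  by rewrite !sumrB subrK.
apply: in_stratumD; last exact: in_stratum_nc.
elim/big_rec: _ => [|m x _ IH]; first by exists 0, 0; rewrite !mulr0 addr0.
have [e ->] := term m; apply: in_stratumD => //; exact: in_stratum_other.
Qed.

End LogRelation.

(** * The restricted foliations *)

Lemma big_lift (B : Type) (idx : B) (op : Monoid.com_law idx) n (i : 'I_n)
    (P : pred 'I_n) (F : 'I_n -> B) :
  \big[op/idx]_(k | P k && (k != i)) F k =
  \big[op/idx]_(k < n.-1 | P (lift i k)) F (lift i k).
Proof.
case: n i P F => [|n] i P F; first by case: i.
rewrite big_mkcond (bigD1_ord i) //= eqxx andbF Monoid.mul1m [RHS]big_mkcond.
by apply: eq_bigr => k _; rewrite eq_sym neq_lift andbT.
Qed.

Lemma sum_delta (B : comNzRingType) (I : finType) (k : I) (F : I -> B) :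
  \sum_c (c == k)%:R * F c = F k.
Proof.
rewrite (bigD1 k) //= eqxx mul1r big1 ?addr0 // => c /negPf ->.
by rewrite mul0r.
Qed.

Section Component.
Variables (K : numFieldType) (n r : nat) (T : der (@nc_const K n r) -> Prop).
Hypothesis T_bracket : forall v w, T v -> T w -> T (lie_bracket v w).
Variables (i : 'I_n) (ir : (i < r)%N).
Local Notation clsn := (@cls (holo K n) (nc_eqn K n r)).
Local Notation G := (fol_restr T i).
Variable omega : 'I_n.-1 -> holo K n.-1.
Hypothesis G_omega : defined_by G omega.

Lemma restr_cls f g : clsn f = clsn g -> restr i f = restr i g.
Proof.
move/cls_eq => [h eh]; apply/eqP; rewrite -subr_eq0 -rmorphB /= eh.
by rewrite (nc_eqnE _ ir) !rmorphM /= restr_var unlift_none !mul0r.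
Qed.

Lemma der_restr_bracket (v v' : der (@nc_const K n r)) (w w' : der (@const K n.-1)) :
  der_restr i v w -> der_restr i v' w' ->
  der_restr i (lie_bracket v v') (lie_bracket w w').
Proof.
move=> vw vw' f g /=; have [f1 e1] := cls_surj (v' (clsn f)).
have [f2 e2] := cls_surj (v (clsn f1)); have [f3 e3] := cls_surj (v (clsn f)).
have [f4 e4] := cls_surj (v' (clsn f3)).
rewrite e1 e2 e3 e4 -rmorphB => /restr_cls <-.
by rewrite (vw' _ _ e1) (vw _ _ e2) (vw _ _ e3) (vw' _ _ e4) rmorphB.
Qed.

(** The saturated restriction is again involutive: the factors that clear the
    denominators only add multiples of the two fields. *)
Lemma omega_bracket w w' : G w -> G w' ->
  \sum_c omega c * (w (w' (var K c)) - w' (w (var K c))) = 0.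
Proof.
move=> Gw Gw'; have [_ GE] := G_omega.
have ow := (GE w).1 Gw; have ow' := (GE w').1 Gw'.
have [s [s0 [v Tv vw]]] := Gw; have [s' [s'0 [v' Tv' vw']]] := Gw'.
have /(GE _).1 : G (lie_bracket (s *: w) (s' *: w')).
  exists 1; split; first exact: oner_neq0.
  exists (lie_bracket v v'); first exact: T_bracket.
  by rewrite scale1r; apply: der_restr_bracket.
set S := \sum_(c < _) omega c * (w _ - _).
have -> : \sum_(c < n.-1) omega c *
    lie_bracket (s *: w) (s' *: w') (var K c) =
    s * s' * S + s * w s' * (\sum_(c < n.-1) omega c * w' (var K c))
    - s' * w' s * (\sum_(c < n.-1) omega c * w (var K c)).
  rewrite !mulr_sumr -big_split -sumrB; apply: eq_bigr => c _ /=.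
  by rewrite !derM; ring.
rewrite ow ow' !mulr0 addr0 subr0.
move/holo_mul_eq0 => [|//] /holo_mul_eq0 [e0|e0].
  by rewrite e0 eqxx in s0.
by rewrite e0 eqxx in s'0.
Qed.

Definition pair_coef (k l : 'I_n.-1) : 'I_n.-1 -> holo K n.-1 :=
  fun c => (c == k)%:R * omega l - (c == l)%:R * omega k.

Lemma vfun_pair k l f :
  vfun (pair_coef k l) f = omega l * pderiv k f - omega k * pderiv l f.
Proof.
rewrite /vfun /pair_coef.
under eq_bigr do rewrite mulrBl -!mulrA.
by rewrite sumrB !sum_delta.
Qed.

Lemma pair_in_G k l : G (vfield (pair_coef k l)).
Proof.
apply/(proj2 G_omega).
under eq_bigr do rewrite /= vfun_var mulrBr !(mulrCA (omega _)).
by rewrite sumrB !sum_delta mulrC subrr.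
Qed.

Hypothesis invG : invariant_hypersurface G (boundary_eqn K r i).

Lemma boundaryE : boundary_eqn K r i =
  \prod_(k < n.-1 | (lift i k < r)%N) var K k.
Proof.
rewrite /boundary_eqn rmorph_prod.
etransitivity; first exact: (big_lift _ i (fun k : 'I_n => (k < r)%N)).
by apply: eq_bigr => k _; rewrite /= restr_var liftK.
Qed.

(** The field omega_l d/dx_k - omega_k d/dx_l is tangent to D_i, whose equation
    is x_k z with z prime to x_k; only the term omega_l z of its value on this
    equation is not visibly divisible by x_k. *)
Lemma omega_divides k l : (lift i k < r)%N -> l != k ->
  divides (var K k) (omega l).
Proof.
move=> kr lk; have [b] := invG (pair_in_G k l) 1.
rewrite mul1r /= vfun_pair boundaryE (bigD1 k) //=.
set z := \prod_(c < _ | _) _; rewrite !pderivM !pderiv_var eqxx eq_sym (negPf lk).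
rewrite mulr1n mulr0n => e; have : divides (var K k) (omega l * z).
  exists (b * z - omega l * pderiv k z + omega k * pderiv l z).
  apply/eqP; rewrite -subr_eq0; apply/eqP; move/eqP: e; rewrite -subr_eq0 => /eqP e.
  by rewrite -[RHS]e; ring.
case/coord_prime => // /coord_ndvd_prod; case.
by rewrite eqxx andbF.
Qed.

(** A coordinate generates a prime ideal of height one, so it cannot divide all
    the coefficients of a form whose zero locus has codimension two. *)
Lemma omega_ndvd j : (lift i j < r)%N -> ~ divides (var K j) (omega j).
Proof.
move=> jr dj; have [codim2 _] := G_omega.
pose p := divides (var K j).
have prime_p : is_prime_ideal p.
  split=> [|a b [a' ->] [b' ->]|a b|/divides_restr|a b].
  - by exists 0; rewrite mulr0.
  - by exists (a' + b'); rewrite mulrDr.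
  - exact: dividesMl.
  - by rewrite rmorph1 => /eqP; rewrite oner_eq0.
  - exact: coord_prime.
have all_p k : p (omega k).
  by have [->//|kj] := eqVneq k j; apply: omega_divides.
have [p0 [p1 [pr0 pr1 p01 p1p [[a p1a np0a] [b pb np1b]]]]] := codim2 p prime_p all_p.
have [_ _ mul1 _ prod1] := pr1.
have p1j : ~ p1 (var K j).
  move=> h; apply: np1b; have [c ->] := pb.
  by rewrite mulrC; apply: mul1.
suff a0 : a = 0 by case: pr0 np0a => [z _ _ _ _]; rewrite a0.
(* Elements of p1 are multiples of x_j whose quotient is again in p1, hence are
   divisible by all powers of x_j. *)
have p1_coef N : forall f (m : 'X_{1..n.-1}), p1 f -> (m j < N)%N -> f m = 0.
  elim: N => // N IH f m /[dup] p1f /p1p [g ef] mN.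
  have p1g : p1 g by move: p1f; rewrite ef => /prod1[|].
  rewrite ef -[LHS]/((fps_var K j * (g : fps K n.-1)) m) fps_varM.
  case: ifP => // mj; apply: IH => //.
  by rewrite mnmBE mnm1E eqxx subn1 -ltnS prednK.
apply: holo_eqP; apply: fpsP => m; rewrite fps0E.
exact: (p1_coef (m j).+1).
Qed.

Variables (j : 'I_n.-1) (jr : (lift i j < r)%N).
Variable eta : 'I_n.-1 -> holo K n.-1.
Hypothesis omegaE : forall k, k != j -> omega k = var K j * eta k.

(** With h = omega_j and y = x_j, the bracket of the fields h d/dx_k - y eta_k d/dy
    and h d/dx_l - y eta_l d/dy is killed by omega; this relation is y h times
    the closedness of eta / h modulo y. *)
Lemma eta_closed k l : k != j -> l != j -> exists e,
  omega j * (pderiv l (eta k) - pderiv k (eta l)) =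
  eta k * pderiv l (omega j) - eta l * pderiv k (omega j) + var K j * e.
Proof.
move=> kj lj; have [->|kl] := eqVneq k l; first by exists 0; ring.
have h0 : omega j != 0.
  by apply/eqP => e; apply: (omega_ndvd jr); exists 0; rewrite e mulr0.
have := omega_bracket (pair_in_G k j) (pair_in_G l j).
rewrite (bigD1 k) // (bigD1 l) 1?eq_sym // (bigD1 j) /=; last first.
  by rewrite !(eq_sym j) kj lj.
rewrite big1 => [|c /andP[/andP[ck cl] cj]]; last first.
  rewrite !vfun_var /pair_coef (negPf ck) (negPf cl) (negPf cj) !mul0r subrr.
  by rewrite -(mulr0 0) !vfunM !mul0r addr0 subrr mulr0.
rewrite !vfun_var /pair_coef !eqxx (negPf kj) (negPf lj) (eq_sym l) (negPf kl).
rewrite !(eq_sym j) (negPf kj) (negPf lj) !mul0r !mul1r !subr0 !sub0r.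
have vfunN a f : vfun a (- f) = - vfun a f :> holo K n.-1.
  by rewrite -sub0r vfunB -[vfun a 0]/(vfun a 0) -{1}(mulr0 0) vfunM !mul0r addr0 sub0r.
rewrite !vfunN; have vfun0 a : vfun a 0 = 0 :> holo K n.-1.
  by rewrite -{1}(mulr0 0) vfunM !mul0r addr0.
rewrite !vfun0 !vfun_pair (omegaE kj) (omegaE lj) !pderivM !pderiv_var eqxx.
rewrite !(eq_sym j) (negPf kj) (negPf lj) ?mulr1n ?mulr0n => e.
exists (eta l * pderiv j (eta k) - eta k * pderiv j (eta l)).
apply: (holo_mulfI h0); apply: (holo_mulfI (var_neq0 K j)).
apply/eqP; rewrite -subr_eq0 -[X in _ == X]e; apply/eqP; ring.
Qed.

End Component.

(** The coefficients of omega are extended to the ambient space so that h stays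
    divisible by the equations of the other components: the glued fields then
    vanish on these components. *)
Lemma lift_log_form (K : numFieldType) (n r : nat) (i : 'I_n)
    (omega : 'I_n.-1 -> holo K n.-1) (j : 'I_n.-1) :
  (forall k l, (lift i k < r)%N -> l != k -> divides (var K k) (omega l)) ->
  (lift i j < r)%N ->
  exists (h : holo K n) (e : 'I_n -> holo K n),
  [/\ omega j = restr i h,
      forall k, k != j -> omega k = var K j * restr i (e (lift i k))
    & forall m : 'I_n, (m < r)%N -> m != i -> m != lift i j ->
        divides (var K m) h].
Proof.
move=> omega_log jr.
have [|z ez] := @prod_coord_divides K n.-1
    (fun k => (lift i k < r)%N && (lift i k != lift i j)) (omega j).
  move=> k /andP[kr kj]; apply: omega_log => //.
  by rewrite eq_sym; apply: contraNneq kj => ->.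
have [Z eZ] := restr_surj i z.
have /boolp.choice[e eP] : forall k : 'I_n, exists e : holo K n,
    forall k', k = lift i k' -> k' != j -> omega k' = var K j * restr i e.
  move=> k; case: (unliftP i k) => [k' ->|->]; last first.
    by exists 0 => k' /eqP; rewrite (negPf (neq_lift _ _)).
  have [kj|kj] := eqVneq k' j.
    by exists 0 => k'' /lift_inj <-; rewrite kj eqxx.
  have [y ey] := omega_log j k' jr kj; have [Y eY] := restr_surj i y.
  by exists Y => k'' /lift_inj <- _; rewrite eY.
exists (\prod_(m < n | ((m < r)%N && (m != lift i j)) && (m != i)) var K m * Z), e.
split=> [|k kj|m mr mi mj]; last 1 first.
- by apply: dividesMr; rewrite (bigD1 m) /= ?mr ?mj ?mi //; eexists.
- rewrite rmorphM /= eZ ez rmorph_prod; congr (_ * _); apply/esym.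
  etransitivity.
    exact: (big_lift _ i (fun m : 'I_n => (m < r)%N && (m != lift i j))).
  by apply: eq_bigr => k _; rewrite /= restr_var liftK.
- exact: eP.
Qed.

(** * Arcs in the stratum *)

Section Arcs.
Variables (K : numFieldType) (n : nat).

Lemma fsub_restr0 (i : 'I_n) (Gam : 'I_n -> fps K 1) (f : holo K n) :
  Gam i = 0 ->
  fsub idfun Gam f = fsub idfun (fun k => Gam (lift i k)) (restr i f).
Proof.
move=> Gi; apply: fpsP => t; rewrite /=; set d := (mdeg t).+1.
have hr (a : 'X_{1..n.-1 < d}) : (mdeg (mnm_restr i a) < d)%N.
  by rewrite mdeg_restr bmdeg.
rewrite (bigID (fun a : 'X_{1..n < d} => bmnm a i == 0%N)) /= addrC big1 ?add0r.
  rewrite (reindex_onto (fun a => BMultinom (hr a))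
    (fun a => BMultinom (mdeg_drop_le i (bmdeg a)))) => [|a /eqP ai]; last first.
    by apply: val_inj; rewrite /= mnm_dropK.
  apply: eq_big => [a|a _] /=.
    by rewrite mnmE unlift_none eqxx bmeqP /= mnm_restrK eqxx.
  suff -> : \prod_(k < n) Gam k ^+ mnm_restr i a k =
      \prod_(k < n.-1) Gam (lift i k) ^+ a k by [].
  transitivity (\prod_(k < n | k != i) Gam k ^+ mnm_restr i a k).
    rewrite (bigD1 i) //; set x := \prod_(_ < _ | _) _.
    by rewrite -[LHS]/(Gam i ^+ _ * _) mnmE unlift_none expr0 mul1r.
  etransitivity; first exact: (big_lift _ i xpredT).
  by apply: eq_bigr => k _; rewrite mnmE liftK.
move=> a ai; have -> : \prod_(k < n) Gam k ^+ bmnm a k = 0.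
  rewrite (bigD1 i) //; set x := \prod_(_ < _ | _) _.
  by rewrite -[LHS]/(Gam i ^+ _ * _) Gi expr0n (negPf ai) mul0r.
by rewrite [X in _ * X]fps0E mulr0.
Qed.

End Arcs.

(** The hypothesis says a / b + a' / b' = N / t - R. *)
Lemma residue_sum (K : numFieldType) (a b a' b' R : fps K 1) c c' N :
  is_residue a b c -> is_residue a' b' c' ->
  tvar * (a * b' + a' * b) = N%:R * (b * b') - tvar * (b * b' * R) ->
  c + c' = N%:R.
Proof.
move=> [p [u [u' [eb uu' ec]]]] [q [v [v' [eb' vv' ec']]]] E.
pose f := a * u'; pose g := a' * v'.
have E' : tvar ^+ q.+1 * f + tvar ^+ p.+1 * g =
    N%:R * (tvar ^+ (p + q) * 1) - tvar ^+ (p + q).+1 * R.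
  have -> : tvar ^+ q.+1 * f + tvar ^+ p.+1 * g =
      (tvar * (a * (tvar ^+ q * (v * v')) * u' + a' * (tvar ^+ p * (u * u')) * v')).
    by rewrite uu' vv' /f /g !exprS; ring.
  transitivity (tvar * (a * b' + a' * b) * u' * v'); first by rewrite eb eb'; ring.
  rewrite E eb eb' !exprS exprD.
  transitivity (N%:R * (tvar ^+ p * tvar ^+ q) * (u * u') * (v * v') -
    tvar * (tvar ^+ p * tvar ^+ q) * (u * u') * (v * v') * R); first by ring.
  by rewrite uu' vv'; ring.
have : (tvar ^+ q.+1 * f + tvar ^+ p.+1 * g) (expt (p + q)) =
    (N%:R * (tvar ^+ (p + q) * 1) - tvar ^+ (p + q).+1 * R) (expt (p + q)).
  by rewrite E'.
rewrite !fpsDE fpsNE !tXE ltnn subr0 fps_natM tXE leqnn subnn expt0 fps1E eqxx.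
move=> <-; congr (_ + _).
  rewrite ec; case: (p) => [|p']; first by rewrite add0n ltnn.
  by rewrite addSn ltnS leq_addl subSS addnK.
rewrite ec'; case: (q) => [|q']; first by rewrite addn0 ltnn.
by rewrite addnS ltnS leq_addr subSS [(p + _)%N]addnC addnK.
Qed.

(** * The index formula *)

Section ComponentIndex.
Variables (K : numFieldType) (n r : nat) (T : der (@nc_const K n r) -> Prop).
Hypothesis T_bracket : forall v w, T v -> T w -> T (lie_bracket v w).
Variables (i : 'I_n) (ir : (i < r)%N).
Variable omega : 'I_n.-1 -> holo K n.-1.
Hypothesis G_omega : defined_by (fol_restr T i) omega.
Hypothesis invG :
  invariant_hypersurface (fol_restr T i) (boundary_eqn K r i).
Variables (j : 'I_n.-1) (jr : (lift i j < r)%N).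
Variable e : 'I_n -> holo K n.
Hypothesis omegaE : forall k, k != j -> omega k = var K j * restr i (e (lift i k)).

(** The form eta of the decomposition omega = omega_j dx_j + x_j eta, normalized
    by eta_j = 0. *)
Definition log_coef (k : 'I_n.-1) : holo K n.-1 :=
  if k == j then 0 else restr i (e (lift i k)).

Lemma component_index : exists (P : {mpoly K[n.-1]}) (c : K),
  [/\ exists2 v : 'I_n.-1 -> K, v j = 0 & P.@[v] != 0,
      is_CS_index omega (var K j) c
    & forall gam : 'I_n.-1 -> fps K 1, (forall k, gam k 0%MM = 0) -> gam j = 0 ->
        P.@[fun k => gam k U_(ord0)%MM] != 0 ->
        is_residue (arc_form log_coef gam) (fsub idfun gam (omega j)) c].
Proof.
have omegaE' k : k != j -> omega k = var K j * log_coef k.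
  by move=> kj; rewrite /log_coef (negPf kj) omegaE.
have ndvd := omega_ndvd G_omega invG jr.
have closed k l : k != j -> l != j -> exists x : fps K n.-1,
    (omega j : fps K n.-1) * (fps_deriv l (log_coef k) - fps_deriv k (log_coef l)) =
    (log_coef k : fps K n.-1) * fps_deriv l (omega j)
      - (log_coef l : fps K n.-1) * fps_deriv k (omega j) + fps_var K j * x.
  move=> kj lj.
  have [x ex] := eta_closed T_bracket ir G_omega invG jr omegaE' kj lj.
  by exists x; exact: (congr1 (@holo_val K n.-1) ex).
have nz : exists2 a : 'X_{1..n.-1}, a j = 0%N & omega j a != 0.
  apply: contrapT => h; apply/ndvd/divides_restr/holo_eqP/fpsP => a.
  rewrite fps0E; apply/eqP; apply: contrapT => /negP ha; apply: h.
  by exists (mnm_restr j a) => //; rewrite mnmE unlift_none.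
have [P [c [[v vj Pv] res]]] := residue_curve_independent closed nz.
exists P, c; split => //; first by exists v.
exists (omega j), log_coef; split.
- move=> k; rewrite -[LHS]/(holo_val (omega k)) [fps_deriv _ _]fps_deriv_var.
  have [<-|kj] := eqVneq j k.
    by rewrite /log_coef eqxx mulr1 -[holo_val 0]/(0 : fps K n.-1) mulr0 addr0.
  by rewrite mulr0 add0r omegaE' 1?eq_sym.
- by move=> [g eg]; apply: ndvd; exists g; rewrite mulrC.
exists P; split.
  exists v => //; rewrite (bigD1 j) //= vj mulr0 add0r big1 // => k kj.
  rewrite -[X in X * _]/(fps_deriv k (fps_var K j) 0%MM) fps_deriv_var eq_sym.
  by rewrite (negPf kj) -[X in X * _]/((0 : fps K n.-1) 0%MM) fps0E mul0r.
move=> gam [gam0 _ gamj] Pg.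
have gj : gam j = 0 :> fps K 1.
  by rewrite -[LHS](fsub_var idfun (gam := fun k => holo_val (gam k))).
exact: (res (fun k => holo_val (gam k))).
Qed.

End ComponentIndex.

Section Glue.
Variables (K : numFieldType) (n r : nat) (T : der (@nc_const K n r) -> Prop).

(** On X_i the field is [hB] times the field omega_j d/dx_k - omega_k d/dx_j,
    which omega kills; [z] collects the part that vanishes on X_i. *)
Lemma glue_restricts (a : 'I_n -> holo K n) (i : 'I_n) (j k : 'I_n.-1)
    (omega : 'I_n.-1 -> holo K n.-1) (hA eA hB : holo K n) (z : holo K n -> holo K n) :
  defined_by (fol_restr T i) omega ->
  omega j = restr i hA -> omega k = var K j * restr i eA ->
  (forall f, vfun a f = hA * hB * pderiv (lift i k) f
     - var K (lift i j) * eA * hB * pderiv (lift i j) f - var K i * z f) ->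
  restricts_into T a i.
Proof.
move=> G_omega oj ok aE.
apply: (restricts_into_fol (w := vfield (pair_coef omega k j)) (b := restr i hB)).
  exact: pair_in_G.
move=> f; rewrite aE !rmorphB !rmorphM /= !restr_var unlift_none liftK /=.
by rewrite !restr_pderiv mul0r subr0 vfun_pair oj ok; ring.
Qed.

Definition glue_coef (i j k : 'I_n) (hA hB eA eB : holo K n) : 'I_n -> holo K n :=
  fun c => (c == k)%:R * (hA * hB) - (c == j)%:R * (var K j * eA * hB)
           - (c == i)%:R * (var K i * eB * hA).

Lemma vfun_glue i j k hA hB eA eB f :
  vfun (glue_coef i j k hA hB eA eB) f = hA * hB * pderiv k f
    - var K j * eA * hB * pderiv j f - var K i * eB * hA * pderiv i f.
Proof.
rewrite /vfun /glue_coef.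
under eq_bigr do rewrite !mulrBl -!mulrA.
by rewrite !sumrB !sum_delta !mulrA.
Qed.

End Glue.

(** On the line through v1 and v2 both polynomials are nonzero polynomials in
    the parameter, so they have a common nonroot. *)
Lemma common_nonroot (K : numFieldType) n m1 m2
    (f1 : 'I_m1 -> 'I_n) (f2 : 'I_m2 -> 'I_n)
    (P1 : {mpoly K[m1]}) (P2 : {mpoly K[m2]}) (v1 v2 : 'I_n -> K) :
  P1.@[v1 \o f1] != 0 -> P2.@[v2 \o f2] != 0 ->
  exists s, P1.@[fun k => (1 - s) * v1 (f1 k) + s * v2 (f1 k)] != 0 /\
            P2.@[fun k => (1 - s) * v1 (f2 k) + s * v2 (f2 k)] != 0.
Proof.
move=> P1v P2v.
pose L c : {poly K} := (1 - 'X) * (v1 c)%:P + 'X * (v2 c)%:P.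
pose comp m (f : 'I_m -> 'I_n) (P : {mpoly K[m]}) := mmap (@polyC K) (L \o f) P.
have compE m (f : 'I_m -> 'I_n) P s :
    (comp m f P).[s] = P.@[fun k => (1 - s) * v1 (f k) + s * v2 (f k)].
  rewrite /comp /mmap horner_sum mevalE; apply: eq_bigr => a _.
  rewrite hornerM hornerC /mmap1 horner_prod; congr (_ * _).
  by apply: eq_bigr => k _; rewrite horner_exp /= /L !hornerE.
have [|s] := @nonroot K (comp _ f1 P1 * comp _ f2 P2).
  apply: mulf_neq0.
    apply: contraNneq P1v => c0; rewrite -(horner0 0) -c0 compE; apply/eqP.
    by apply: meval_eq => k; rewrite /= subr0 mul1r mul0r addr0.
  apply: contraNneq P2v => c0; rewrite -(horner0 1) -c0 compE; apply/eqP.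
  by apply: meval_eq => k; rewrite /= subrr mul1r mul0r add0r.
by rewrite hornerM mulf_eq0 negb_or !compE => /andP[]; exists s.
Qed.

Section Sum.
Variables (K : numFieldType) (n r : nat) (r_le_n : (r <= n)%N).
Variable T : der (@nc_const K n r) -> Prop.
Hypothesis T_torsionless : torsionless_quotient T.
Hypothesis T_semistable : semistable T.
Variables (i j : 'I_n) (ir : (i < r)%N) (jr : (j < r)%N) (ij : i != j).
Variables (i' j' : 'I_n.-1).
Hypotheses (ij' : j = lift i j') (ji' : i = lift j i').
Variables (oA oB : 'I_n.-1 -> holo K n.-1).
Hypotheses (G_A : defined_by (fol_restr T i) oA)
           (G_B : defined_by (fol_restr T j) oB).
Variables (hA hB : holo K n) (eA eB : 'I_n -> holo K n).
Hypotheses (oAj : oA j' = restr i hA)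
  (oAk : forall k, k != j' -> oA k = var K j' * restr i (eA (lift i k)))
  (hA_log : forall m : 'I_n, (m < r)%N -> m != i -> m != j -> divides (var K m) hA).
Hypotheses (oBi : oB i' = restr j hB)
  (oBk : forall k, k != i' -> oB k = var K i' * restr j (eB (lift j k)))
  (hB_log : forall m : 'I_n, (m < r)%N -> m != j -> m != i -> divides (var K m) hB).

Local Notation a k := (glue_coef i j k hA hB (eA k) (eB k)).

Lemma glue_log k : k != i -> k != j ->
  forall c : 'I_n, (c < r)%N -> divides (var K c) (a k c).
Proof.
move=> ki kj c cr; apply: dividesB; first apply: dividesB.
- have [ck|_] := eqVneq c k; last by exists 0; rewrite mul0r mulr0.
  by apply/dividesMl/dividesMr/hA_log; rewrite ?ck // -?ck.
- have [->|_] := eqVneq c j; last by exists 0; rewrite mul0r mulr0.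
  by apply/dividesMl/dividesMr; eexists.
- have [->|_] := eqVneq c i; last by exists 0; rewrite mul0r mulr0.
  by apply/dividesMl/dividesMr; eexists.
Qed.

Lemma glue_in_T k (ki : k != i) (kj : k != j) : T (nc_vfield (glue_log ki kj)).
Proof.
apply: mem_of_restrictions => // m mr.
have [->|mi] := eqVneq m i.
  case: (unliftP i k) => [k' ek|ek]; last by rewrite ek eqxx in ki.
  have kj' : k' != j' by apply: contraNneq kj => e; rewrite ek e ij'.
  apply: (glue_restricts (k := k') (hB := hB)
    (z := fun f => eB k * hA * pderiv i f) G_A oAj (oAk kj')) => f.
  by rewrite vfun_glue -ek -ij'; ring.
have [->|mj] := eqVneq m j.
  case: (unliftP j k) => [k' ek|ek]; last by rewrite ek eqxx in kj.
  have ki' : k' != i' by apply: contraNneq ki => e; rewrite ek e ji'.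
  apply: (glue_restricts (k := k') (hB := hA)
    (z := fun f => eA k * hB * pderiv j f) G_B oBi (oBk ki')) => f.
  by rewrite vfun_glue -ek -ji'; ring.
apply: restricts_into0 => // f; rewrite vfun_glue.
have hAm := hA_log mr mi mj; have hBm := hB_log mr mj mi.
apply: dividesB; [apply: dividesB|].
- by apply/dividesMr/dividesMr.
- by apply/dividesMr/dividesMl.
- by apply/dividesMr/dividesMl.
Qed.

(** The quotients of the components of the glued field by the coordinates, q
    standing for h_i h_j / x_k. *)
Definition glue_log_coef k (q : holo K n) : 'I_n -> holo K n :=
  fun c => (c == k)%:R * q - (c == j)%:R * (eA k * hB) - (c == i)%:R * (eB k * hA).

Variable tau : 'I_n -> K.
Hypotheses (tau_i : tau i = 0) (tau_j : tau j = 0).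
Let Gam c : fps K 1 := fps_const 1 (tau c) * tvar.
Local Notation ev F := (fsub idfun Gam (holo_val F)).

Let Gam0 c : Gam c 0%MM = 0.
Proof. by rewrite -expt0 /Gam mulrC tM0. Qed.
Let Gami : Gam i = 0. Proof. by rewrite /Gam tau_i rmorph0 mul0r. Qed.
Let Gamj : Gam j = 0. Proof. by rewrite /Gam tau_j rmorph0 mul0r. Qed.

Let evM F G : ev (F * G) = ev F * ev G. Proof. exact: fsubM. Qed.
Let evB F G : ev (F - G) = ev F - ev G. Proof. exact: fsubB. Qed.
Let ev0 : ev 0 = 0. Proof. exact: fsub0. Qed.
Let ev_var c : ev (var K c) = Gam c. Proof. exact: fsub_var. Qed.
Let ev_sum (I : finType) (P : pred I) (F : I -> holo K n) :
  ev (\sum_(k | P k) F k) = \sum_(k | P k) ev (F k).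
Proof.
apply: (big_morph (fun x => ev x)) => [x y|]; [exact: fsubD|exact: fsub0].
Qed.

Let ev_stratum F : in_stratum i j F -> ev F = 0.
Proof.
move=> [p [q ->]]; rewrite [LHS]fsubD -!/(holo_val (_ * _)).
by rewrite [X in X + _]evM [X in _ + X]evM !ev_var Gami Gamj !mul0r addr0.
Qed.

Lemma arc_form_stratum (p l : 'I_n) (l' : 'I_n.-1) (e : 'I_n -> holo K n) :
  l = lift p l' -> Gam p = 0 ->
  arc_form (log_coef p l' e) (fun k => Gam (lift p k)) =
  \sum_(k | (k != l) && (k != p)) ev (e k) * fps_const 1 (tau k).
Proof.
move=> el Gp; rewrite /arc_form.
rewrite (big_lift _ p (fun k => k != l)) [RHS]big_mkcond; apply: eq_bigr => k _.
rewrite el (inj_eq lift_inj) /log_coef; have [_|kl] := eqVneq k l' => /=.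
  by rewrite [X in X * _]fsub0 mul0r.
rewrite -(fsub_restr0 _ Gp) fps_derivM fps_derivC mulr0 addr0.
by rewrite fps_deriv_var mulr1.
Qed.

Lemma count_other (X : fps K 1) :
  \sum_(k < n | (k != j) && (k != i)) (if (k < r)%N then X else 0) = (r - 2)%:R * X.
Proof.
have E : \sum_(k < n) (if (k < r)%N then X else 0) = r%:R * X.
  rewrite -big_mkcond (big_ord_narrow r_le_n) sumr_const card_ord.
  by rewrite mulr_natl.
have r2 : (2 <= r)%N.
  move: ir jr ij; case: (r) => [|[|//]] //; rewrite !ltnS !leqn0 -val_eqE /=.
  by move=> /eqP -> /eqP ->.
have -> : (r - 2)%:R * X = r%:R * X - X - X by rewrite natrB //; ring.
rewrite -E [in RHS](bigD1 i) // [in RHS](bigD1 j) 1?eq_sym //= ir jr.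
have -> (x : fps K 1) : X + (X + x) - X - X = x by ring.
by apply: eq_bigl => k; rewrite andbC.
Qed.

(** The semistable relation for the glued field of index k, pulled back to the
    arc (tau_c t) and multiplied by dx_k = tau_k dt; the sum over k of the terms
    h_i h_j dx_k / x_k is (r - 2) h_i h_j dt / t, and R dt is the pullback of the
    logarithmic differential of a unit. *)
Lemma stratum_identity : exists R,
  tvar * (arc_form (log_coef i j' eA) (fun k => Gam (lift i k)) * ev hB +
          arc_form (log_coef j i' eB) (fun k => Gam (lift j k)) * ev hA) =
  (r - 2)%:R * (ev hA * ev hB) - tvar * (ev hA * ev hB * R).
Proof.
have [U [U' rel]] := semistable_relation r_le_n T_semistable.
have /boolp.choice[q qP] : forall k : 'I_n, exists q : holo K n,
    k != i -> k != j -> (k < r)%N -> hA * hB = var K k * q.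
  move=> k; have [ki|ki] := eqVneq k i; first by exists 0.
  have [kj|kj] := eqVneq k j; first by exists 0.
  have [kr|kr] := boolP (k < r)%N; last by exists 0.
  by have [x ex] := hA_log kr ki kj; exists (x * hB); rewrite ex mulrA.
(* The logarithmic derivative along x_k of the product of the units. *)
pose W k := \sum_(m < r) ev (U' m) * ev (pderiv k (U m)).
have key k : k != i -> k != j ->
    (if (k < r)%N then ev (q k) else 0) - ev (eA k) * ev hB - ev (eB k) * ev hA =
    ev hA * ev hB * W k.
  move=> ki kj; pose G := glue_log_coef k (q k).
  have aG (c : 'I_n) : (c < r)%N -> a k c = var K c * G c.
    rewrite /glue_coef /G /glue_log_coef => cr.
    have [ck|ck] := eqVneq c k.
      rewrite -ck in ki kj qP *; rewrite (negPf ki) (negPf kj) !mul0r !mul1r !subr0.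
      by rewrite -qP // ck.
    have [->|cj] := eqVneq c j; first by rewrite (eq_sym j i) (negPf ij) ?mulr1n ?mulr0n; ring.
    have [->|ci] := eqVneq c i; first by rewrite ?mulr1n ?mulr0n; ring.
    by rewrite !mul0r; ring.
  have := ev_stratum (rel _ G (glue_log ki kj) aG (glue_in_T ki kj) i j ir jr ij).
  rewrite evB => /eqP; rewrite subr_eq0 => /eqP E.
  transitivity (ev (\sum_(m < r) G (widen_ord r_le_n m))); last first.
    rewrite E ev_sum /W mulr_sumr; apply: eq_bigr => m _.
    rewrite evM vfun_glue !evB !evM !ev_var Gami Gamj !mul0r !subr0.
    by ring.
  rewrite -(big_ord_narrow (F := G) r_le_n) /G /glue_log_coef !sumrB.
  have pick (l : 'I_n) (F : holo K n) :
      \sum_(c < n | (c < r)%N) (c == l)%:R * F = if (l < r)%N then F else 0.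
    rewrite big_mkcond (bigD1 l) //= eqxx mul1r big1 ?addr0 // => c /negPf ->.
    by rewrite mul0r if_same.
  rewrite !pick ir jr !evB !evM; case: ifP => // _.
  by rewrite ev0.
exists (\sum_(k < n | (k != j) && (k != i)) fps_const 1 (tau k) * W k).
rewrite (arc_form_stratum eA ij' Gami) (arc_form_stratum eB ji' Gamj).
rewrite [X in _ + X * _](eq_bigl (fun k => (k != j) && (k != i))); last first.
  by move=> k; rewrite andbC.
rewrite -count_other !mulr_suml -big_split !mulr_sumr -sumrB.
apply: eq_bigr => k /andP[kj ki] /=; have := key k ki kj.
case: ifP => kr E.
  have eX : ev hA * ev hB = fps_const 1 (tau k) * tvar * ev (q k).
    by rewrite -evM (qP k ki kj kr) evM ev_var.
  transitivity (tvar * fps_const 1 (tau k) *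
      (ev (eA k) * ev hB + ev (eB k) * ev hA)); first by ring.
  transitivity (fps_const 1 (tau k) * tvar * ev (q k) - tvar * fps_const 1 (tau k) *
      (ev (q k) - ev (eA k) * ev hB - ev (eB k) * ev hA)); first by ring.
  by rewrite E -eX; ring.
transitivity (- (tvar * fps_const 1 (tau k)) *
  (0 - ev (eA k) * ev hB - ev (eB k) * ev hA)); first by ring.
by rewrite E; ring.
Qed.

End Sum.

(** Both residues can be computed along one line in the intersection of X_i and
    X_j, in a direction generic for both indices. *)
Lemma camacho_sad_sum (K : numFieldType) (n r : nat) (r_le_n : (r <= n)%N)
    (T : der (@nc_const K n r) -> Prop) :
  foliation 1 T -> semistable T ->
  (forall i : 'I_n, (i < r)%N ->
     invariant_hypersurface (fol_restr T i) (boundary_eqn K r i)) ->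
  forall i j : 'I_n, (i < r)%N -> (j < r)%N -> i != j ->
  forall oA oB : 'I_n.-1 -> holo K n.-1,
    defined_by (fol_restr T i) oA ->
    defined_by (fol_restr T j) oB ->
  exists c c' : K,
    [/\ is_CS_index oA (restr i (var K j)) c,
        is_CS_index oB (restr j (var K i)) c'
      & c + c' = r%:R - 2%:R].
Proof.
move=> [_ T_bracket T_torsionless _] T_semistable inv i j ir jr ij oA oB GA GB.
case: (unliftP i j) => [j' ij'|e]; last by rewrite e eqxx in ij.
case: (unliftP j i) => [i' ji'|e]; last by rewrite e eqxx in ij.
have jr' : (lift i j' < r)%N by rewrite -ij'.
have ir' : (lift j i' < r)%N by rewrite -ji'.
have [hA [eA [oAj oAk hA_log]]] :=
  lift_log_form (omega_divides GA (inv i ir)) jr'.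
have [hB [eB [oBi oBk hB_log]]] :=
  lift_log_form (omega_divides GB (inv j jr)) ir'.
rewrite -ij' in hA_log; rewrite -ji' in hB_log.
have [P [c [[v vj Pv] csA resA]]] :=
  component_index T_bracket ir GA (inv i ir) jr' oAk.
have [Q [c' [[w wi Qw] csB resB]]] :=
  component_index T_bracket jr GB (inv j jr) ir' oBk.
have yj : restr i (var K j) = var K j'.
  by rewrite [in LHS]ij' restr_var liftK.
have yi : restr j (var K i) = var K i'.
  by rewrite [in LHS]ji' restr_var liftK.
exists c, c'; rewrite yj yi; split => //.
pose v1 k := oapp v 0 (unlift i k); pose v2 k := oapp w 0 (unlift j k).
have v1E : v1 \o lift i =1 v by move=> k; rewrite /v1 /= liftK.
have v2E : v2 \o lift j =1 w by move=> k; rewrite /v2 /= liftK.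
have [||s [Ps Qs]] := @common_nonroot _ n _ _ (lift i) (lift j) P Q v1 v2.
- by rewrite (meval_eq P v1E).
- by rewrite (meval_eq Q v2E).
pose tau k := (1 - s) * v1 k + s * v2 k.
have tau_i : tau i = 0.
  rewrite /tau; have -> : v1 i = 0 by rewrite /v1 unlift_none.
  by have -> : v2 i = 0; [rewrite /v2 ji' liftK | rewrite !mulr0 addr0].
have tau_j : tau j = 0.
  rewrite /tau; have -> : v2 j = 0 by rewrite /v2 unlift_none.
  by have -> : v1 j = 0; [rewrite /v1 ij' liftK | rewrite !mulr0 addr0].
pose Gam k : fps K 1 := fps_const 1 (tau k) * tvar.
have Gam0 k : Gam k 0%MM = 0 by rewrite -expt0 /Gam mulrC tM0.
have Gam_tau k : tau k = 0 -> Gam k = 0.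
  by move=> e; rewrite /Gam e rmorph0 mul0r.
have tangent_Gam k : Gam k U_(ord0)%MM = tau k.
  by rewrite fps_constM /= eqxx mulr1.
have rA : is_residue (arc_form (log_coef i j' eA) (fun k => Gam (lift i k)))
    (fsub idfun Gam hA) c.
  rewrite (fsub_restr0 hA (Gam_tau _ tau_i)) -oAj; apply: resA => //.
    by rewrite -ij' Gam_tau.
  by under [X in P.@[X]]funext do rewrite tangent_Gam.
have rB : is_residue (arc_form (log_coef j i' eB) (fun k => Gam (lift j k)))
    (fsub idfun Gam hB) c'.
  rewrite (fsub_restr0 hB (Gam_tau _ tau_j)) -oBi; apply: resB => //.
    by rewrite -ji' Gam_tau.
  by under [X in Q.@[X]]funext do rewrite tangent_Gam.
have [S eS] := stratum_identity r_le_n T_torsionless T_semistable ir jr ij ij' ji'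
  GA GB oAj oAk hA_log oBi oBk hB_log tau_i tau_j.
rewrite (residue_sum rA rB eS) natrB //.
move: ir jr ij; case: (r) => [|[|//]] //; rewrite !ltnS !leqn0 -val_eqE /=.
by move=> /eqP -> /eqP ->.
Qed.

Theorem proposition3p12 (R : realType) (n r : nat) (n_ge3 : (3 <= n)%N)
    (r_le_n : (r <= n)%N) (T : der (@nc_const R[i] n r) -> Prop) :
  foliation 1 T -> semistable T ->
  (forall i : 'I_n, (i < r)%N ->
     invariant_hypersurface (fol_restr T i) (boundary_eqn R[i] r i)) ->
  forall i j : 'I_n, (i < r)%N -> (j < r)%N -> i != j ->
  forall omega_i omega_j : 'I_n.-1 -> holo R[i] n.-1,
    defined_by (fol_restr T i) omega_i ->
    defined_by (fol_restr T j) omega_j ->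
  exists c_i c_j : R[i],
    [/\ is_CS_index omega_i (restr i (var R[i] j)) c_i,
        is_CS_index omega_j (restr j (var R[i] i)) c_j
      & c_i + c_j = r%:R - 2%:R].
Proof. exact: camacho_sad_sum. Qed.
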